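(* Let ${\bf m}=(m_1,\ldots,m_n)$ with $m_i\in\mathbb{Z}^+$. For an $n$-dimensional unitary braid code with block size ${\bf m}$ and parameters $g$ and $q^{(i)}_{\bf J}$, there exists a decoding algorithm (which recovers ${\bf x}$ from the codeword of the ${\bf m}$-block tagged at ${\bf x}$, without a codebook) with computational complexity $O(n_0^2)$, where $n_0=\max_{i,{\bf J}}\lceil\log_2 q^{(i)}_{\bf J}\rceil$ and $n,{\bf m},g$ are regarded as fixed.
   Context: Grids and blocks. $G^c_{\bf M}=\mathbb{Z}_{M_1}\times\cdots\times\mathbb{Z}_{M_n}$; vector inequalities are componentwise; for ${\bf m}<{\bf M}$ the ${\bf m}$-block at ${\bf x}$ is $B_{\bf m}({\bf x})=\{{\bf j}\bmod{\bf M}:{\bf x}\le{\bf j}<{\bf x}+{\bf m},\ {\bf j}\in\mathbb{Z}^n\}$; the codeword of ${\bf x}$ under a color mapping $\Phi$ is the multiset $\Phi(B_{\bf m}({\bf x}))$. Standard unitary braid code. Let $g\ge2$ be an integer and, for each $i$ and each ${\bf 0}_n\le{\bf J}<{\bf m}$, let $q^{(i)}_{\bf J}\in\mathbb{Z}^+$; put $Q_i=\mathrm{lcm}_{\bf J}\,q^{(i)}_{\bf J}$, $M_i=gm_iQ_i$, $\ell^{(i)}_{\bf J}=gq^{(i)}_{\bf J}$. Let $\mathcal{C}^{(i)}_{\bf J}$ be finite sets with $|\mathcal{C}^{(i)}_{\bf J}|=\ell^{(i)}_{\bf J}$, pairwise disjoint for different pairs $({\bf J},i)$, let $\Gamma^{(i)}_{\bf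 J}:\mathbb{Z}_{\ell^{(i)}_{\bf J}}\to\mathcal{C}^{(i)}_{\bf J}$ be bijections, and $\Phi^{(i)}_{\bf J}(l)=\Gamma^{(i)}_{\bf J}(l\bmod\ell^{(i)}_{\bf J})$. Writing $x_i=j_im_i+r_i$, $0\le r_i<m_i$, ${\bf r}=(r_1,\ldots,r_n)$, the standard unitary braid code on $G^c_{\bf M}$ is $\Phi({\bf x})=(\Phi^{(1)}_{\bf r}(j_1),\ldots,\Phi^{(n)}_{\bf r}(j_n))$. Non-standard unitary braid code. For ${\bf L}\le{\bf M}$ (with $L_i\ge2m_i$), a unitary braid code on $G^c_{\bf L}$ is obtained from a standard one on $G^c_{\bf M}$ by restricting to $\{0,\ldots,L_1-1\}\times\cdots\times\{0,\ldots,L_n-1\}$ and, for each $i$ with $L_i\ne M_i$ and $m_i\mid L_i$ and each ${\bf J}$ whose components other than the $i$-th are zero, replacing the value $\Phi^{(i)}_{\bf J}(L_i/m_i-1)$ by a new color factor $d^{(i)}_{\bf J}$ (new factors for different ${\bf J}$ are distinct and not in any $\mathcal{C}^{(i)}_{\bf J}$), all other values unchanged. Representation convention. Each color is represented by its index ${\bf J}$ and its $n$ coordinate factors, each coordinate factor $\Gamma^{(i)}_{\bf J}(s)$ being represented by the integer $s\in\{0,\ldots,\ell^{(i)}_{\bf J}-1\}$. Complexity counts elementary operations.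
   Formalization: Some non-standard codes with n ≥ 2 and some m_i not dividing L_i have distinct points sharing a codeword; so recovery of x is claimed if n = 1, or all m_i divide L_i, or the codeword determines x. The time bound, K(n_0^2+1), holds for all x. *)

(* Defs.v *)
(* MathComp world. *)
From HB Require Import structures.
From mathcomp Require Import all_boot.

Set Implicit Arguments.
Unset Strict Implicit.
Unset Printing Implicit Defensive.

(* The integer points x with 0 <= x_i < M i for every i.  The same type serves
   for the cyclic grid G^c_M and for the indices 0 <= J < m. *)
Notation grid M := {dffun forall i, 'I_(M i)}.

(* ------------------------- Unitary braid codes ------------------------- *)

(* [ub_side] is the vector L of the grid G^c_L carrying the code.  [ub_Gamma i J]
   is only used on {0, ..., g q^(i)_J - 1}, and [ub_new i J] (the new color
   factor d^(i)_J) only for the (i, J) selected by [ub_replaced] below. *)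
Record ub_data (n : nat) (m : 'I_n -> nat) (g : nat) := UbData {
  ub_q : 'I_n -> grid m -> nat;
  ub_side : 'I_n -> nat;
  ub_factor : eqType;
  ub_Gamma : 'I_n -> grid m -> nat -> ub_factor;
  ub_new : 'I_n -> grid m -> ub_factor }.

Section UnitaryBraidCode.

Variables (n : nat) (m : 'I_n -> nat) (m_gt0 : forall i, 0 < m i) (g : nat).
Variable U : ub_data m g.

Local Notation L := (ub_side U).

Definition ub_len (i : 'I_n) (J : grid m) : nat := g * ub_q U i J.

Definition ub_Q (i : 'I_n) : nat := \big[lcmn/1]_(J : grid m) ub_q U i J.

(* The side M_i of the standard code. *)
Definition ub_std_side (i : 'I_n) : nat := g * m i * ub_Q i.

(* The set C^(i)_J of color factors, listed through Gamma^(i)_J. *)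
Definition ub_factors (i : 'I_n) (J : grid m) : seq (ub_factor U) :=
  [seq ub_Gamma U i J s | s <- iota 0 (ub_len i J)].

Definition ub_replaced (i : 'I_n) (J : grid m) : bool :=
  [&& L i != ub_std_side i, m i %| L i
    & [forall k : 'I_n, (k != i) ==> (J k == 0 :> nat)]].

(* [uniq (ub_factors i J)] says that Gamma^(i)_J is a bijection from
   Z_(g q^(i)_J) onto C^(i)_J. *)
Record unitary_braid_code : Prop := UnitaryBraidCode {
  ub_q_gt0 : forall i J, 0 < ub_q U i J;
  ub_side_ge : forall i, 2 * m i <= L i;
  ub_side_le : forall i, L i <= ub_std_side i;
  ub_Gamma_bij : forall i J, uniq (ub_factors i J);
  ub_factors_disjoint : forall i J i' J', (i, J) != (i', J') ->
    ~~ has (mem (ub_factors i J)) (ub_factors i' J');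
  ub_new_fresh : forall i J i' J', ub_replaced i J ->
    ub_new U i J \notin ub_factors i' J';
  ub_new_inj : forall i J J', ub_replaced i J -> ub_replaced i J' ->
    ub_new U i J = ub_new U i J' -> J = J' }.

(* Phi^(i)_J(l), after the replacement of its value at l = L_i / m_i - 1. *)
Definition ub_coord (i : 'I_n) (J : grid m) (l : nat) : ub_factor U :=
  if ub_replaced i J && (l == L i %/ m i - 1) then ub_new U i J
  else ub_Gamma U i J (l %% ub_len i J).

Definition residue (x : grid L) : grid m :=
  [ffun i => Ordinal (ltn_pmod (x i) (m_gt0 i))].

Definition ub_color (x : grid L) : {ffun 'I_n -> ub_factor U} :=
  [ffun i => ub_coord i (residue x) (x i %/ m i)].

Definition block (x : grid L) : {set grid L} :=
  [set y : grid L | [exists J : grid m, [forall i, y i == (x i + J i) %% L i :> nat]]].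

(* Multisets are sequences up to [perm_eq]. *)
Definition codeword (x : grid L) : seq {ffun 'I_n -> ub_factor U} :=
  [seq ub_color y | y in block x].

(* If n >= 2 and m_k does not divide L_k, a block wrapping around in direction k
   misses some residues J, and with them the digits modulo q^(i)_J (i != k), so
   that distinct points may share a codeword. *)
Definition unambiguous (x : grid L) : Prop :=
  forall y : grid L, perm_eq (codeword y) (codeword x) -> y = x.

(* n_0 = max of ceil(log_2 q^(i)_J) *)
Definition ub_n0 : nat :=
  \max_(i < n) \max_(J : grid m) up_log 2 (ub_q U i J).

(* A represented color is its index J together with n integers; the integer s
   in coordinate i stands for Gamma^(i)_J(s) if s < g q^(i)_J, and the first
   unused value s = g q^(i)_J stands for the new factor d^(i)_J. *)
Definition symbol : Type := (grid m * {ffun 'I_n -> nat})%type.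

Definition symbol_valid (c : symbol) : bool :=
  [forall i, (c.2 i < ub_len i c.1)
          || (c.2 i == ub_len i c.1) && ub_replaced i c.1].

Definition symbol_color (c : symbol) : {ffun 'I_n -> ub_factor U} :=
  [ffun i => if c.2 i < ub_len i c.1 then ub_Gamma U i c.1 (c.2 i)
             else ub_new U i c.1].

(* w lists, in an arbitrary order, the represented colors of the codeword of
   x; a block has \prod_i m_i points. *)
Definition represents_codeword (w : (\prod_(i < n) m i).-tuple symbol)
    (x : grid L) : Prop :=
  all symbol_valid w /\ perm_eq [seq symbol_color c | c <- w] (codeword x).

End UnitaryBraidCode.

(* ------------------------- Bit-level algorithms ------------------------ *)

(* Programs over registers holding finite bit strings, of which only the first
   bit is accessible (stacks).  A program mentions finitely many registers, and
   each instruction touches one bit, so the cost below is, up to a constant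
   factor, an upper bound for multi-tape Turing machine time; in particular
   integer arithmetic is not available at unit cost. *)
Inductive cmd (R : Type) : Type :=
| Skip
| Push of R & bool
| Pop of R
| Seq of cmd R & cmd R
| Case of R & cmd R & cmd R & cmd R (* empty register, first bit 0, first bit 1 *)
| While of R & cmd R. (* loop as long as the register is nonempty *)

Arguments Skip {R}.

Section Semantics.

Variable R : eqType.

Definition store := R -> seq bool.

Definition update (st : store) (r : R) (s : seq bool) : store :=
  fun r' => if r' == r then s else st r'.

Definition select (s : seq bool) (c c0 c1 : cmd R) : cmd R :=
  match s with
  | [::] => c
  | false :: _ => c0
  | true :: _ => c1
  end.

(* exec c st t st': from store st, program c halts in store st' after exactly
   t elementary operations. *)
Inductive exec : cmd R -> store -> nat -> store -> Prop :=
| ExecSkip st : exec Skip st 1 st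
| ExecPush r b st : exec (Push r b) st 1 (update st r (b :: st r))
| ExecPop r st : exec (Pop r) st 1 (update st r (behead (st r)))
| ExecSeq c1 c2 st t1 st1 t2 st2 :
    exec c1 st t1 st1 -> exec c2 st1 t2 st2 ->
    exec (Seq c1 c2) st (t1 + t2) st2
| ExecCase r c c0 c1 st t st' :
    exec (select (st r) c c0 c1) st t st' ->
    exec (Case r c c0 c1) st t.+1 st'
| ExecWhileStop r c st :
    st r = [::] -> exec (While r c) st 1 st
| ExecWhileStep r c st t1 st1 t2 st2 :
    st r <> [::] -> exec c st t1 st1 -> exec (While r c) st1 t2 st2 ->
    exec (While r c) st (t1 + t2).+1 st2.

End Semantics.

(* Binary numerals, least significant bit first. *)
Definition bits (k : nat) : seq bool :=
  mkseq (fun e => odd (k %/ 2 ^ e)) (up_log 2 k.+1).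

Definition nat_of_bits (s : seq bool) : nat :=
  foldr (fun (b : bool) v => b + v.*2) 0 s.

(* Registers: the parameters q^(i)_J and L_i, the index component J_i and the
   i-th coordinate factor of the c-th represented color, the result x_i, and
   work space. *)
Inductive reg (n : nat) (m : 'I_n -> nat) : Type :=
| RegQ of 'I_n & grid m
| RegL of 'I_n
| RegJ of 'I_(\prod_(i < n) m i) & 'I_n
| RegS of 'I_(\prod_(i < n) m i) & 'I_n
| RegOut of 'I_n
| RegWork of nat.

Section RegEq.

Variables (n : nat) (m : 'I_n -> nat).

Local Notation code := ('I_n * grid m + 'I_n + 'I_(\prod_(i < n) m i) * 'I_n
  + 'I_(\prod_(i < n) m i) * 'I_n + 'I_n + nat)%type.

Definition reg_code (r : reg m) : code :=
  match r with
  | RegQ i J => inl (inl (inl (inl (inl (i, J)))))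
  | RegL i => inl (inl (inl (inl (inr i))))
  | RegJ c i => inl (inl (inl (inr (c, i))))
  | RegS c i => inl (inl (inr (c, i)))
  | RegOut i => inl (inr i)
  | RegWork k => inr k
  end.

Definition reg_decode (u : code) : reg m :=
  match u with
  | inl (inl (inl (inl (inl (i, J))))) => RegQ i J
  | inl (inl (inl (inl (inr i)))) => RegL m i
  | inl (inl (inl (inr (c, i)))) => RegJ c i
  | inl (inl (inr (c, i))) => RegS c i
  | inl (inr i) => RegOut m i
  | inr k => RegWork m k
  end.

Lemma reg_codeK : cancel reg_code reg_decode.
Proof. by case. Qed.

HB.instance Definition _ := Equality.copy (reg m) (can_type reg_codeK).

End RegEq.

Definition input_store (n : nat) (m : 'I_n -> nat) (g : nat) (U : ub_data m g)
    (w : (\prod_(i < n) m i).-tuple (symbol m)) : store (reg m) :=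
  fun r =>
    match r with
    | RegQ i J => bits (ub_q U i J)
    | RegL i => bits (ub_side U i)
    | RegJ c i => bits ((tnth w c).1 i)
    | RegS c i => bits ((tnth w c).2 i)
    | RegOut _ => [::]
    | RegWork _ => [::]
    end.

Definition output (n : nat) (m : 'I_n -> nat) (st : store (reg m)) (i : 'I_n) :
    nat := nat_of_bits (st (RegOut m i)).

(* Main.v *)
Require Import Defs.
From mathcomp Require Import all_boot.
From mathcomp Require Import zify.
From Stdlib Require Import FunctionalExtensionality.

Set Implicit Arguments.
Unset Strict Implicit.
Unset Printing Implicit Defensive.

(* The decoder treats each coordinate i separately.  If x_i + 2 m_i <= L_i, no
   color of the block is replaced and the block does not wrap around in direction
   i, so that, r = x_i mod m_i being one of m_i possibilities, x_i / m_i solves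
   the congruences j + [J_i < r] = s_J modulo g q_J over the colors (J, s) of the
   codeword; their least solution is again the quotient of a point whose block
   shows the same colors in direction i.  Otherwise x_i is one of the 2 m_i
   numbers L_i - t.  A bounded number of candidates thus remains, and the decoder
   outputs the first one consistent with the codeword: the right number of colors
   for every residue and, unless m_i does not divide L_i and the block wraps
   around, the right colors.  Consistent candidates y_i in all directions form a
   point y with the codeword of x.  If m_i does not divide L_i, a block that wraps
   around is determined by its residues; and if n = 1 or every m_i divides L_i,
   the unwrapped colors carry all the congruences, so that y = x.

   For the complexity, functions of the input are evaluated on a stack of work
   registers.  A loop whose body performs a bounded number of linear-time
   operations lets each register grow by O(1) bits per round, hence O(n_0) rounds
   cost O(n_0^2) without any finer analysis.  Multiplication, division and the
   binary extended Euclidean algorithm, hence Chinese remaindering, have this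
   shape. *)

(** * Bit-level routines *)

(** One program must serve all codes with the given [n], [m] and [g], and [ub_n0] is not among its
    inputs. The budget is therefore read off the input itself: a unary clock, one more than the
    total number of input bits, drives every loop, and is O([ub_n0] + 1) for a valid code. Euclid's
    algorithm by repeated division would put a quadratic division inside O(n_0) rounds, hence a
    cubic bound without amortisation; the binary variant needs only shifts and subtractions per
    round. It wants an odd modulus, so common powers of 2 are stripped beforehand.

    The decoder never decides in which situation it is: formulas valid in one situation only are
    evaluated anyway, and one test, passed by [x i] itself, filters the values. The congruences are
    solved modulo the lcm of the lengths that occur in the codeword. When a block wrapping in
    another direction misses some residues, this lcm may be too small to determine [x i]; the point
    found then only shares the codeword of [x], whence the case [unambiguous]. *)

Section Numerals.

Lemma nat_of_bits_lt s : nat_of_bits s < 2 ^ size s.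
Proof. by elim: s => //= b s IH; rewrite expnS; case: b => /=; lia. Qed.

Lemma odd_nat_of_bits s : odd (nat_of_bits s) = head false s.
Proof. by case: s => //= b s; rewrite oddD odd_double addbF oddb. Qed.

Lemma half_nat_of_bits s : (nat_of_bits s)./2 = nat_of_bits (behead s).
Proof. by case: s => //= b s; rewrite halfD doubleK odd_double andbF; case: b. Qed.

Lemma nat_of_bits_digits k p :
  nat_of_bits (mkseq (fun e => odd (k %/ 2 ^ e)) p) = k %% 2 ^ p.
Proof.
elim: p k => [|p IH] k; first by rewrite modn1.
rewrite /mkseq /= expn0 divn1 -[1]addn0 iotaDl -map_comp.
rewrite (eq_map (g := fun e => odd (k./2 %/ 2 ^ e))); last first.
  by move=> e /=; rewrite expnS divnMA divn2.
rewrite -[map _ _]/(mkseq _ p) IH -[in RHS](odd_double_half k) expnS -!muln2.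
have lt : k./2 %% 2 ^ p < 2 ^ p by rewrite ltn_mod expn_gt0.
rewrite {2}(divn_eq k./2 (2 ^ p)) mulnDl addnCA -mulnA [2 ^ p * 2]mulnC modnMDl.
move: lt; set r := k./2 %% 2 ^ p; set d := 2 ^ p => lt.
by rewrite modn_small; case: (odd k) => /=; lia.
Qed.

Lemma bitsK k : nat_of_bits (bits k) = k.
Proof. by rewrite nat_of_bits_digits modn_small // up_logP. Qed.

Lemma size_bits k : size (bits k) = up_log 2 k.+1.
Proof. by rewrite size_mkseq. Qed.

End Numerals.

(** * Timed execution and programs that move stacks *)

Section Machine.

Variable R : eqType.
Implicit Type st : store R.

(** An upper bound instead of an exact time, so that costs can be rounded up at each composition. *)
Definition runs c st T st' := exists2 t, exec c st t st' & t <= T.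

Lemma runs_eq (c : cmd R) st T T' st' st'' :
  runs c st T st' -> T <= T' -> st' =1 st'' -> runs c st T' st''.
Proof.
move=> [t e le_t] leT eq; exists t; last exact: leq_trans leT.
by rewrite -(functional_extensionality _ _ eq).
Qed.

Lemma runs_skip st : runs Skip st 1 st.
Proof. by exists 1 => //; constructor. Qed.

Lemma runs_push r b st : runs (Push r b) st 1 (update st r (b :: st r)).
Proof. by exists 1 => //; constructor. Qed.

Lemma runs_pop r st : runs (Pop r) st 1 (update st r (behead (st r))).
Proof. by exists 1 => //; constructor. Qed.

Lemma runs_seq c1 c2 st T1 st1 T2 st2 :
  runs c1 st T1 st1 -> runs c2 st1 T2 st2 -> runs (Seq c1 c2) st (T1 + T2) st2.
Proof.
move=> [t1 e1 l1] [t2 e2 l2]; exists (t1 + t2); last exact: leq_add.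
by econstructor; eauto.
Qed.

Lemma runs_case r c c0 c1 st T st' :
  runs (select (st r) c c0 c1) st T st' -> runs (Case r c c0 c1) st T.+1 st'.
Proof. by move=> [t e l]; exists t.+1 => //; constructor. Qed.

Lemma runs_while_stop r c st : st r = [::] -> runs (While r c) st 1 st.
Proof. by move=> e; exists 1 => //; constructor. Qed.

Lemma runs_while_step r c st T1 st1 T2 st2 :
  st r <> [::] -> runs c st T1 st1 -> runs (While r c) st1 T2 st2 ->
  runs (While r c) st (T1 + T2).+1 st2.
Proof.
move=> ne [t1 e1 l1] [t2 e2 l2]; exists (t1 + t2).+1; last by rewrite ltnS leq_add.
by econstructor; eauto.
Qed.

Lemma updateE st r s : update st r s r = s.
Proof. by rewrite /update eqxx. Qed.

Lemma update_neq st r s r' : r' != r -> update st r s r' = st r'.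
Proof. by rewrite /update => /negPf ->. Qed.

Lemma update_id st r s : st r = s -> update st r s =1 st.
Proof. by move=> e r'; rewrite /update; case: eqP => // ->. Qed.

Definition clear (r : R) := While r (Pop r).

Lemma runs_clear r st : runs (clear r) st (2 * size (st r) + 1) (update st r [::]).
Proof.
have [p] := ubnP (size (st r)); elim: p st => // p IH st lt_p.
case def_r: (st r) lt_p => [|b s] lt_p.
  apply: runs_eq (runs_while_stop _ def_r) _ _ => // r'.
  by rewrite update_id.
have ne : st r <> [::] by rewrite def_r.
have lt : size (update st r (behead (st r)) r) < p by rewrite updateE def_r.
apply: runs_eq (runs_while_step ne (runs_pop r st) (IH _ lt)) _ _.
  by rewrite updateE def_r /=; lia.
by move=> r'; rewrite /update; case: eqP.
Qed.

Definition move_rev (a b : R) :=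
  While a (Case a Skip (Seq (Pop a) (Push b false)) (Seq (Pop a) (Push b true))).

Lemma runs_move_rev a b st : a != b ->
  runs (move_rev a b) st (4 * size (st a) + 1)
    (update (update st b (rev (st a) ++ st b)) a [::]).
Proof.
move=> ab; have ba : b != a by rewrite eq_sym.
have [p] := ubnP (size (st a)); elim: p st => // p IH st lt_p.
case def_a: (st a) lt_p => [|d s] lt_p.
  apply: runs_eq (runs_while_stop _ def_a) _ _ => // r'.
  by rewrite /= update_id ?update_id // update_neq.
have ne : st a <> [::] by rewrite def_a.
pose st1 := update (update st a s) b (d :: st b).
have body : runs (Case a Skip (Seq (Pop a) (Push b false)) (Seq (Pop a) (Push b true)))
    st 3 st1.
  apply: runs_case; rewrite def_a /=.
  have := runs_seq (runs_pop a st) (runs_push b d _).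
  by rewrite def_a /= update_neq // /st1; case: (d).
have eq_a : st1 a = s by rewrite /st1 update_neq // updateE.
have lt : size (st1 a) < p by rewrite eq_a.
apply: runs_eq (runs_while_step ne body (IH _ lt)) _ _.
  by rewrite eq_a /=; lia.
move=> r'; rewrite eq_a rev_cons cat_rcons /st1 /update.
by case: (r' =P a) => // _; case: (r' =P b) => // _; rewrite eqxx.
Qed.

Definition move a b tmp := Seq (move_rev a tmp) (move_rev tmp b).

Lemma runs_move a b tmp st : a != b -> a != tmp -> b != tmp -> st tmp = [::] ->
  runs (move a b tmp) st (8 * size (st a) + 2)
    (update (update st b (st a ++ st b)) a [::]).
Proof.
move=> ab at_ bt e; have ta : tmp != b by rewrite eq_sym.
apply: runs_eq (runs_seq (runs_move_rev _ at_) (runs_move_rev _ ta)) _ _.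
  by rewrite update_neq 1?eq_sym // updateE e cats0 size_rev; lia.
have [ta' ba] : tmp != a /\ b != a by rewrite ![_ == a]eq_sym.
move=> r'; rewrite /update eqxx (negPf ta') (negPf ba) (negPf bt) e cats0 revK.
case: (r' =P tmp) => [->|_]; first by rewrite (negPf ta) (negPf ta').
by case: (r' =P b) => [->|_]; rewrite ?(negPf ba).
Qed.

(** A stack can only be read by destroying it: its content goes to [tmp] in reverse order, and on
    the way back each bit is pushed on both [a] and [b]. *)
Definition copy (a b tmp : R) := Seq (move_rev a tmp)
  (While tmp (Case tmp Skip (Seq (Pop tmp) (Seq (Push a false) (Push b false)))
                            (Seq (Pop tmp) (Seq (Push a true) (Push b true))))).

Lemma runs_copy a b tmp st : a != b -> a != tmp -> b != tmp ->
    st tmp = [::] -> st b = [::] ->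
  runs (copy a b tmp) st (9 * size (st a) + 2) (update st b (st a)).
Proof.
move=> ab at_ bt e eb.
have ba : b != a by rewrite eq_sym.
have ta : tmp != a by rewrite eq_sym.
have tb : tmp != b by rewrite eq_sym.
have back st1 : runs (While tmp (Case tmp Skip
      (Seq (Pop tmp) (Seq (Push a false) (Push b false)))
      (Seq (Pop tmp) (Seq (Push a true) (Push b true))))) st1
    (5 * size (st1 tmp) + 1)
    (update (update (update st1 a (rev (st1 tmp) ++ st1 a))
       b (rev (st1 tmp) ++ st1 b)) tmp [::]).
  have [p] := ubnP (size (st1 tmp)); elim: p st1 => // p IH st1 lt_p.
  case def_t: (st1 tmp) lt_p => [|d s] lt_p.
    apply: runs_eq (runs_while_stop _ def_t) _ _ => // r' /=.
    by rewrite update_id ?update_id ?update_id // !update_neq.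
  have ne : st1 tmp <> [::] by rewrite def_t.
  pose st2 := update (update (update st1 tmp s) a (d :: st1 a)) b (d :: st1 b).
  have body : runs (Case tmp Skip
      (Seq (Pop tmp) (Seq (Push a false) (Push b false)))
      (Seq (Pop tmp) (Seq (Push a true) (Push b true)))) st1 4 st2.
    have H : runs (Seq (Pop tmp) (Seq (Push a d) (Push b d))) st1 3 st2.
      apply: runs_eq (runs_seq (runs_pop _ _)
        (runs_seq (runs_push a d _) (runs_push b d _))) _ _ => // r'.
      by rewrite def_t /st2 /update (negPf ba) (negPf at_) (negPf bt).
    by apply: runs_case; rewrite def_t /=; case: (d) H.
  have eq_t : st2 tmp = s by rewrite /st2 2?update_neq // updateE.
  have lt : size (st2 tmp) < p by rewrite eq_t.
  apply: runs_eq (runs_while_step ne body (IH _ lt)) _ _.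
    by rewrite eq_t /=; lia.
  move=> r'; rewrite eq_t rev_cons !cat_rcons /st2 /update.
  case: (r' =P tmp) => // _; rewrite !eqxx (negPf ab).
  by case: (r' =P b) => // _; case: (r' =P a).
apply: runs_eq (runs_seq (runs_move_rev _ at_) (back _)) _ _.
  by rewrite update_neq // updateE e cats0 size_rev; lia.
move=> r'; rewrite /update !eqxx (negPf ta) e cats0 revK eb !cats0.
rewrite (negPf ba) (negPf bt) cats0.
case: (r' =P tmp) => [->|_]; first by rewrite (negPf tb) e.
by case: (r' =P b) => // _; case: (r' =P a) => [->|].
Qed.

(** * Bit-serial arithmetic with a carry *)

Section Transducer.

(* A bitwise operation with carry: [fc c x y] is the next carry and [fo c x y]
   the output bit; missing input bits are read as 0. *)
Variables fc fo : bool -> bool -> bool -> bool.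

Fixpoint tout k (c : bool) (u v : seq bool) : seq bool :=
  if k is k'.+1 then
    fo c (head false u) (head false v)
      :: tout k' (fc c (head false u) (head false v)) (behead u) (behead v)
  else [::].

Fixpoint tfin k (c : bool) (u v : seq bool) : bool :=
  if k is k'.+1 then tfin k' (fc c (head false u) (head false v)) (behead u) (behead v)
  else c.

Lemma size_tout k c u v : size (tout k c u v) = k.
Proof. by elim: k c u v => //= k IH c u v; rewrite IH. Qed.

Lemma toutD k l c u v : tout (k + l) c u v =
  tout k c u v ++ tout l (tfin k c u v) (drop k u) (drop k v).
Proof.
elim: k c u v => [|k IH] c u v; first by rewrite !drop0.
by rewrite addSn /= IH -!drop1 !drop_drop !addn1.
Qed.

Lemma tfinD k l c u v :
  tfin (k + l) c u v = tfin l (tfin k c u v) (drop k u) (drop k v).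
Proof.
elim: k c u v => [|k IH] c u v; first by rewrite !drop0.
by rewrite addSn /= IH -!drop1 !drop_drop !addn1.
Qed.

Variables (u v s o : R).
Hypothesis uniq_uvso : uniq [:: u; v; s; o].

(** The only state besides the registers is the position in the program: the carry, kept as the
    single bit of [s], and the two input bits select a branch where the next carry and the output
    bit are hard-coded. *)
Definition tstep :=
  let Z c x y := Seq (Pop u) (Seq (Pop v) (Seq (Pop s)
                   (Seq (Push s (fc c x y)) (Push o (fo c x y))))) in
  let B x y := Case s (Z false x y) (Z false x y) (Z true x y) in
  let A x := Case v (B x false) (B x false) (B x true) in
  Case u (A false) (A false) (A true).

Definition tstore st k c :=
  update (update (update (update st u (drop k (st u))) v (drop k (st v)))
    s [:: tfin k c (st u) (st v)]) o (rev (tout k c (st u) (st v)) ++ st o).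

Lemma tstoreE st k c : [/\ tstore st k c u = drop k (st u),
  tstore st k c v = drop k (st v), tstore st k c s = [:: tfin k c (st u) (st v)],
  tstore st k c o = rev (tout k c (st u) (st v)) ++ st o
  & forall r, r \notin [:: u; v; s; o] -> tstore st k c r = st r].
Proof.
move: uniq_uvso; rewrite /= !inE !negb_or -!andbA.
move=> /and4P[uv us uo /and4P[vs vo so _]].
rewrite /tstore; split; rewrite /update.
- by rewrite (negPf uo) (negPf us) (negPf uv) eqxx.
- by rewrite (negPf vo) (negPf vs) eqxx.
- by rewrite (negPf so) eqxx.
- by rewrite eqxx.
move=> r; rewrite !inE !negb_or => /and4P[ru rv rs ro].
by rewrite (negPf ru) (negPf rv) (negPf rs) (negPf ro).
Qed.

Lemma tstore_in st st' : (forall r, r \notin [:: u; v; s; o] -> st r = st' r) ->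
  [/\ st u = st' u, st v = st' v, st s = st' s & st o = st' o] -> st =1 st'.
Proof.
move=> out [eu ev es eo] r; have [|/out//] := boolP (r \in [:: u; v; s; o]).
by rewrite !inE => /or4P[] /eqP->.
Qed.

Lemma tstoreD st k l c : st s = [:: c] ->
  tstore (tstore st k c) l (tfin k c (st u) (st v)) =1 tstore st (k + l) c.
Proof.
move=> es; have [eu ev _ eo out] := tstoreE st k c.
have [eu' ev' es' eo' out'] := tstoreE st (k + l) c.
have [eu2 ev2 es2 eo2 out2] :=
  tstoreE (tstore st k c) l (tfin k c (st u) (st v)).
apply: tstore_in => [r nr|]; first by rewrite out2 // out // out'.
rewrite eu2 ev2 es2 eo2 eu ev eo eu' ev' es' eo' !drop_drop tfinD toutD.
by rewrite rev_cat catA [k + l]addnC.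
Qed.

Lemma runs_tstep st c : st s = [:: c] -> runs tstep st 8 (tstore st 1 c).
Proof.
move=> es; have [eu ev es' eo out] := tstoreE st 1 c.
move: uniq_uvso; rewrite /= !inE !negb_or -!andbA.
move=> /and4P[uv us uo /and4P[vs vo so _]].
set fin := [:: _] in es'.
suff H : runs (Seq (Pop u) (Seq (Pop v) (Seq (Pop s)
   (Seq (Push s (fc c (head false (st u)) (head false (st v))))
     (Push o (fo c (head false (st u)) (head false (st v)))))))) st 5 (tstore st 1 c).
  rewrite /tstep; apply: runs_case.
  by case: (st u) H => [|[] ?] /= H; apply: runs_case;
     case: (st v) H => [|[] ?] /= H; apply: runs_case; rewrite es;
     case: (c) H => /= H.
apply: runs_eq (runs_seq (runs_pop _ _) (runs_seq (runs_pop _ _)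
  (runs_seq (runs_pop _ _) (runs_seq (runs_push _ _ _) (runs_push _ _ _))))) _ _ => //.
apply: tstore_in => [r nr|].
  rewrite out //; move: nr; rewrite !inE !negb_or => /and4P[ru rv rs ro].
  by rewrite /update (negPf ru) (negPf rv) (negPf rs) (negPf ro).
rewrite eu ev es' eo /update !eqxx !drop1 /=.
rewrite (negPf uv) (negPf us) (negPf uo) (negPf vs) (negPf vo) (negPf so).
rewrite [v == u]eq_sym [s == u]eq_sym [s == v]eq_sym [o == u]eq_sym [o == v]eq_sym.
rewrite [o == s]eq_sym (negPf uv) (negPf us) (negPf uo) (negPf vs) (negPf vo) (negPf so).
by rewrite es /= .
Qed.

(** An exhausted operand reads as 0 and popping it is harmless, so either operand may drive the
    loop. *)
Lemma runs_tloop r st c : r \in [:: u; v] -> st s = [:: c] ->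
  runs (While r tstep) st (9 * size (st r) + 1) (tstore st (size (st r)) c).
Proof.
move=> r_uv; have [p] := ubnP (size (st r)); elim: p st c => // p IH st c lt_p es.
have [e0|ne] := eqVneq (st r) [::].
  apply: runs_eq (runs_while_stop _ e0) _ _; rewrite ?e0 //= => r'.
  have [eu ev es' eo out] := tstoreE st 0 c.
  by move: r'; apply: tstore_in => [r' /out //|]; rewrite eu ev es' eo !drop0.
have [eu ev es' eo out] := tstoreE st 1 c.
have er : tstore st 1 c r = behead (st r).
  by move: r_uv; rewrite -drop1 !inE => /orP[] /eqP->.
have sz : size (st r) = (size (behead (st r))).+1 by case: (st r) ne.
have lt : size (tstore st 1 c r) < p by rewrite er; rewrite sz in lt_p.
apply: runs_eq (runs_while_step (elimN eqP ne) (runs_tstep es) (IH _ _ lt es')) _ _.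
  by rewrite er sz; lia.
by move=> r'; rewrite tstoreD // er sz add1n.
Qed.

(** A loop can test one register only; the second loop treats the bits of [v] beyond the length of
    [u]. The result appears on [o] with its most significant bit on top, hence the reversals in the
    operations below. *)
Definition tcore := Seq (Push s false) (Seq (While u tstep) (While v tstep)).

Lemma runs_tcore st : st s = [::] -> st o = [::] ->
  exists k st', [/\ k = maxn (size (st u)) (size (st v)),
    runs tcore st (9 * (size (st u) + size (st v)) + 3) st',
    st' u = [::] /\ st' v = [::],
    st' s = [:: tfin k false (st u) (st v)] /\
    st' o = rev (tout k false (st u) (st v))
    & forall r, r \notin [:: u; v; s; o] -> st' r = st r].
Proof.
move=> es eo.
move: (uniq_uvso); rewrite /= !inE !negb_or -!andbA.
move=> /and4P[uv us uo /and4P[vs vo so _]].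
pose st0 := update st s [:: false].
have e0 : st0 s = [:: false] by rewrite /st0 updateE.
have eu0 : st0 u = st u by rewrite /st0 update_neq.
have ev0 : st0 v = st v by rewrite /st0 update_neq.
have eo0 : st0 o = [::] by rewrite /st0 update_neq // eq_sym.
have push : runs (Push s false) st 1 st0.
  by apply: runs_eq (runs_push _ _ _) _ _ => // r; rewrite es.
have l1 := runs_tloop (mem_head _ _) e0.
have [eu ev es' eo' out] := tstoreE st0 (size (st0 u)) false.
have v_in : v \in [:: u; v] by rewrite !inE eqxx orbT.
have l2 := runs_tloop v_in es'.
set st2 := tstore _ (size (tstore _ _ _ _)) _ in l2.
exists (maxn (size (st u)) (size (st v))), st2; split => //.
- apply: runs_eq (runs_seq push (runs_seq l1 l2)) _ _ => //.
  by rewrite ev eu0 ev0 size_drop; clear; lia.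
- rewrite /st2; have [-> -> _ _ _] := tstoreE (tstore st0 (size (st0 u)) false)
    (size (tstore st0 (size (st0 u)) false v)) (tfin (size (st0 u)) false (st0 u) (st0 v)).
  by rewrite eu ev drop_size drop_size.
- have max : size (st u) + (size (st v) - size (st u)) = maxn (size (st u)) (size (st v)).
    by rewrite maxnE.
  have [_ _ es2 eo2 _] := tstoreE st0 (maxn (size (st u)) (size (st v))) false.
  move: es2 eo2; rewrite -max -tstoreD // eu0 ev0 eo0 cats0 -tstoreD //.
  by rewrite /st2 ev eu0 ev0 size_drop; split.
move=> r nr; have [_ _ _ _ out2] := tstoreE (tstore st0 (size (st0 u)) false)
    (size (tstore st0 (size (st0 u)) false v)) (tfin (size (st0 u)) false (st0 u) (st0 v)).
rewrite /st2 out2 // out // /st0 update_neq //.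
by move: nr; rewrite !inE !negb_or => /and4P[].
Qed.

End Transducer.

Definition add_carry (c x y : bool) := (c && x) || (c && y) || (x && y).
Definition add_bit (c x y : bool) := c (+) x (+) y.
Definition sub_borrow (c x y : bool) := if x then c && y else c || y.

Lemma value_head s : nat_of_bits s = head false s + (nat_of_bits (behead s)).*2.
Proof. by case: s. Qed.

Lemma tout_add k c u v : size u <= k -> size v <= k ->
  nat_of_bits (tout add_carry add_bit k c u v ++ [:: tfin add_carry k c u v]) =
  c + nat_of_bits u + nat_of_bits v.
Proof.
elim: k c u v => [|k IH] c u v; first by case: u v => // -[] //=; case: c.
move=> su sv /=; rewrite IH ?size_behead; try lia.
rewrite (value_head u) (value_head v).
by case: c; case: (head false u); case: (head false v); rewrite /= ; lia.
Qed.

(** The subtrahend and the incoming borrow stand on the left to stay within the natural numbers; the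
    final borrow weighs [2 ^ k]. *)
Lemma tout_sub k c u v : size u <= k -> size v <= k ->
  nat_of_bits (tout sub_borrow add_bit k c u v) + nat_of_bits v + c =
  nat_of_bits u + 2 ^ k * tfin sub_borrow k c u v.
Proof.
elim: k c u v => [|k IH] c u v; first by case: u v => // -[] //=; case: c.
move=> su sv /=.
have := IH (sub_borrow c (head false u) (head false v)) (behead u) (behead v).
rewrite !size_behead expnS (value_head u) (value_head v) => /(_ _ _).
set a := nat_of_bits (tout _ _ _ _ _ _).
set b := tfin _ _ _ _ _; set d := 2 ^ k; clearbody a b d.
move: (nat_of_bits _) (nat_of_bits _) => x y H.
have {}H : a + y + sub_borrow c (head false u) (head false v) = x + d * b.
  by apply: H; lia.
by move: H; rewrite -mulnA; move: (d * b) => e;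
  case: c; case: (head false u); case: (head false v); rewrite /= ; lia.
Qed.

Ltac read_store := rewrite /update; repeat match goal with
  | |- context [?a == ?a] => rewrite eqxx
  | H : is_true (?a != ?b) |- context [?a == ?b] => rewrite (negPf H)
  end.

Section Operations.

Variables (u v s o : R).
Hypothesis uniq_uvso : uniq [:: u; v; s; o].

Let out_update st st' t : (forall r, r \notin [:: u; v; s; o] -> st' r = st r) ->
  st' u = t -> st' v = [::] -> st' s = [::] -> st' o = [::] ->
  st s = [::] -> st o = [::] -> st' =1 update (update st u t) v [::].
Proof.
move: uniq_uvso; rewrite /= !inE !negb_or -!andbA.
move=> /and4P[uv us uo /and4P[vs vo so _]] out eu ev es eo es0 eo0.
have [vu su ou] : [/\ v != u, s != u & o != u] by rewrite ![_ == u]eq_sym.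
have [sv ov] : s != v /\ o != v by rewrite ![_ == v]eq_sym.
apply: (@tstore_in u v s o) => [r nr|].
  rewrite out //; move: nr; rewrite !inE !negb_or => /and4P[ru rv rs ro].
  by rewrite !update_neq.
by rewrite eu ev es eo /update !eqxx (negPf uv) (negPf su) (negPf sv) (negPf ou)
   (negPf ov).
Qed.

Definition add_op := Seq (tcore add_carry add_bit u v s o)
  (Seq (Case s Skip (Push o false) (Push o true)) (Seq (Pop s) (move_rev o u))).

Lemma runs_add st : st s = [::] -> st o = [::] ->
  exists t, [/\ runs add_op st (20 * (size (st u) + size (st v)).+1)
      (update (update st u t) v [::]),
    nat_of_bits t = nat_of_bits (st u) + nat_of_bits (st v)
    & size t = (maxn (size (st u)) (size (st v))).+1].
Proof.
move=> es eo.
have [k [st1 [def_k run1 [eu1 ev1] [es1 eo1] out1]]] :=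
  runs_tcore add_carry add_bit uniq_uvso es eo.
move: (uniq_uvso); rewrite /= !inE !negb_or -!andbA.
move=> /and4P[uv us uo /and4P[vs vo so _]].
have [vu su ou] : [/\ v != u, s != u & o != u] by rewrite ![_ == u]eq_sym.
have [sv ov] : s != v /\ o != v by rewrite ![_ == v]eq_sym.
have os : o != s by rewrite eq_sym.
set d := tfin _ _ _ _ _ in es1; set w := tout _ _ _ _ _ _ in eo1.
have run2 : runs (Case s Skip (Push o false) (Push o true)) st1 2
    (update st1 o (rev (w ++ [:: d]))).
  apply: runs_case; rewrite es1 /= rev_cat /= -eo1.
  by have := runs_push o d st1; case: (d).
exists (w ++ [:: d]); split.
- apply: runs_eq (runs_seq run1 (runs_seq run2
    (runs_seq (runs_pop _ _) (runs_move_rev _ ou)))) _ _.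
    rewrite update_neq // /update eqxx size_rev size_cat size_tout def_k /=; clear; lia.
  apply: out_update => //.
  + move=> r nr; rewrite -out1 //; move: nr; rewrite !inE !negb_or => /and4P[*].
    by read_store.
  + by read_store; rewrite eu1 cats0 revK.
  + by read_store.
  + by read_store; rewrite es1.
  + by read_store.
- by rewrite tout_add // def_k (leq_maxl, leq_maxr).
by rewrite size_cat size_tout addn1 def_k.
Qed.

(** A final borrow signals a negative difference; the digits are then discarded, which gives the
    truncated subtraction of [nat]. *)
Definition sub_op := Seq (tcore sub_borrow add_bit u v s o)
  (Seq (Case s Skip (move_rev o u) (clear o)) (Pop s)).

Lemma runs_sub st : st s = [::] -> st o = [::] ->
  exists t, [/\ runs sub_op st (20 * (size (st u) + size (st v)).+1)
      (update (update st u t) v [::]),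
    nat_of_bits t = nat_of_bits (st u) - nat_of_bits (st v)
    & size t <= maxn (size (st u)) (size (st v))].
Proof.
move=> es eo.
have [k [st1 [def_k run1 [eu1 ev1] [es1 eo1] out1]]] :=
  runs_tcore sub_borrow add_bit uniq_uvso es eo.
move: (uniq_uvso); rewrite /= !inE !negb_or -!andbA.
move=> /and4P[uv us uo /and4P[vs vo so _]].
have [vu su ou] : [/\ v != u, s != u & o != u] by rewrite ![_ == u]eq_sym.
have [sv ov] : s != v /\ o != v by rewrite ![_ == v]eq_sym.
have os : o != s by rewrite eq_sym.
set d := tfin _ _ _ _ _ in es1; set w := tout _ _ _ _ _ _ in eo1.
have val : nat_of_bits w + nat_of_bits (st v) = nat_of_bits (st u) + 2 ^ k * d.
  by rewrite -(@tout_sub k false) ?addn0 // def_k (leq_maxl, leq_maxr).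
have lt : nat_of_bits w < 2 ^ k.
  by rewrite -[k in X in _ < X](size_tout sub_borrow add_bit k false (st u) (st v)) nat_of_bits_lt.
have sz : size (st1 o) = maxn (size (st u)) (size (st v)).
  by rewrite eo1 size_rev size_tout.
exists (if d then [::] else w); split.
- have run2 : runs (Case s Skip (move_rev o u) (clear o)) st1
      (4 * size (st1 o) + 2)
      (update (update st1 u (if d then [::] else w)) o [::]).
    apply: runs_eq (runs_case (T := 4 * size (st1 o) + 1) _) _ _; first last.
    + by move=> r; apply: erefl.
    + by clear; lia.
    rewrite es1 /=; case: (d).
      apply: runs_eq (runs_clear _ _) _ _; first by clear; lia.
      move=> r; rewrite /update; case: (r =P o) => // _.
      by case: (r =P u) => // ->.
    apply: runs_eq (runs_move_rev _ ou) _ _ => // r.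
    by rewrite eu1 cats0 eo1 revK.
  apply: runs_eq (runs_seq run1 (runs_seq run2 (runs_pop _ _))) _ _.
    by rewrite sz; clear; lia.
  apply: out_update => //.
  + move=> r nr; rewrite -out1 //; move: nr; rewrite !inE !negb_or => /and4P[*].
    by read_store.
  + by read_store.
  + by read_store.
  + by read_store; rewrite es1.
  + by read_store.
- move: val lt; clear; case: d => /=; lia.
by case: (d); rewrite // size_tout def_k.
Qed.

(** The comparison is the final borrow of the subtraction, whose digits are thrown away. *)
Definition ltn_op := Seq (tcore sub_borrow add_bit u v s o)
  (Seq (clear o) (move_rev s u)).

Lemma runs_ltn st : st s = [::] -> st o = [::] ->
  exists t, [/\ runs ltn_op st (20 * (size (st u) + size (st v)).+1)
      (update (update st u t) v [::]),
    nat_of_bits t = (nat_of_bits (st u) < nat_of_bits (st v))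
    & size t = 1].
Proof.
move=> es eo.
have [k [st1 [def_k run1 [eu1 ev1] [es1 eo1] out1]]] :=
  runs_tcore sub_borrow add_bit uniq_uvso es eo.
move: (uniq_uvso); rewrite /= !inE !negb_or -!andbA.
move=> /and4P[uv us uo /and4P[vs vo so _]].
have [vu su ou] : [/\ v != u, s != u & o != u] by rewrite ![_ == u]eq_sym.
have [sv ov] : s != v /\ o != v by rewrite ![_ == v]eq_sym.
have os : o != s by rewrite eq_sym.
set d := tfin _ _ _ _ _ in es1; set w := tout _ _ _ _ _ _ in eo1.
have val : nat_of_bits w + nat_of_bits (st v) = nat_of_bits (st u) + 2 ^ k * d.
  by rewrite -(@tout_sub k false) ?addn0 // def_k (leq_maxl, leq_maxr).
have lt : nat_of_bits w < 2 ^ k.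
  by rewrite -[k in X in _ < X](size_tout sub_borrow add_bit k false (st u) (st v)) nat_of_bits_lt.
have sz : size (st1 o) = maxn (size (st u)) (size (st v)).
  by rewrite eo1 size_rev size_tout.
exists [:: d]; split => //.
- apply: runs_eq (runs_seq run1 (runs_seq (runs_clear _ _) (runs_move_rev _ su))) _ _.
    by rewrite sz update_neq // es1 /=; clear; lia.
  apply: out_update => //.
  + move=> r nr; rewrite -out1 //; move: nr; rewrite !inE !negb_or => /and4P[*].
    by read_store.
  + by read_store; rewrite es1 eu1.
  + by read_store.
  + by read_store.
  + by read_store.
rewrite /= addn0; move: val lt; clear; case: d => /=; lia.
Qed.

End Operations.

End Machine.

(** * Functions computable in linear and quadratic time *)

Section Computable.

Variables (R : eqType) (W : nat -> R) (W_inj : injective W).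

Lemma W_eq i j : (W i == W j) = (i == j).
Proof. exact: inj_eq. Qed.

(* [ready x b st]: the store [st] holds the input [x], and the registers
   [W k] with [b <= k] are free.  The bounds [szb K] and [tmb K] on sizes and
   times play the role of O-classes. *)
Record setting := Setting {
  dom : Type;
  ready : dom -> nat -> store R -> Prop;
  szb : nat -> dom -> nat;
  tmb : nat -> dom -> nat;
  ready_free : forall x b st k, ready x b st -> b <= k -> st (W k) = [::];
  ready_update : forall x b st s, ready x b st -> ready x b.+1 (update st (W b) s);
  szbS : forall K x, szb K x < szb K.+1 x;
  tmb_gt0 : forall x, 0 < tmb 1 x;
  tmbD : forall K K' x, tmb K x + tmb K' x = tmb (K + K') x;
  szb_tmb : forall K x, szb K x <= tmb K.+1 x }.

Section Closure.

Variable D : setting.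
Implicit Types (f g : dom D -> nat) (x : dom D) (st : store R).

(** Stack discipline: the registers from [W b] on being free, the value is left in [W b] and all
    other registers are restored. Program and constant may depend on the stack height [b], never on
    the input [x]. *)
Definition computes f := forall b, exists c K, forall x st, ready x b st ->
  exists s, [/\ runs c st (tmb K x) (update st (W b) s),
    nat_of_bits s = f x & size s <= szb K x].

Lemma szb_leq K K' x : K <= K' -> szb K x <= szb K' x.
Proof.
move=> /subnK <-; elim: (K' - K) => // k IH.
by rewrite addSn (leq_trans IH) // ltnW // szbS.
Qed.

Lemma tmbS K x : tmb K.+1 x = tmb K x + tmb 1 x.
Proof. by rewrite tmbD addn1. Qed.

Lemma tmb_const k x : k <= tmb k x.
Proof.
elim: k => // k IH; rewrite tmbS.
by have := tmb_gt0 x; lia.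
Qed.

Lemma tmbM c K x : c * tmb K x = tmb (c * K) x.
Proof.
elim: c => [|c IH]; first by rewrite !mul0n; have := tmbD 0 0 x; rewrite addn0; lia.
by rewrite !mulSn IH tmbD.
Qed.

Lemma computes_ext f g : f =1 g -> computes f -> computes g.
Proof.
move=> fg cf b; have [c [K H]] := cf b; exists c, K => x st /H[s].
by rewrite fg; exists s.
Qed.

Lemma computes0 : computes (fun=> 0).
Proof.
move=> b; exists Skip, 1 => x st r; exists [::]; split => //.
apply: runs_eq (runs_skip _) (tmb_gt0 x) _ => r'.
by rewrite update_id // (ready_free r).
Qed.

Lemma computes_push (d : bool) f : computes f -> computes (fun x => d + (f x).*2).
Proof.
move=> cf b; have [c [K H]] := cf b.
exists (Seq c (Push (W b) d)), K.+1 => x st /H[s [run val sz]].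
exists (d :: s); split => /=.
- apply: runs_eq (runs_seq run (runs_push _ _ _)) _ _.
    by rewrite tmbS leq_add2l tmb_gt0.
  by move=> r; rewrite /update eqxx; case: eqP.
- by rewrite val.
exact: leq_ltn_trans sz (szbS _ _).
Qed.

Lemma computes_double f : computes f -> computes (fun x => (f x).*2).
Proof. exact: (computes_push false). Qed.

Lemma computes_const k : computes (fun=> k).
Proof.
have [p] := ubnP k; elim: p k => // p IH k lt_kp.
have [->|k_gt0] := posnP k; first exact: computes0.
apply: (computes_ext (f := fun=> odd k + (k./2).*2)) => [x|].
  exact: odd_double_half.
by apply: computes_push; apply: IH; lia.
Qed.

Lemma computes_half f : computes f -> computes (fun x => (f x)./2).
Proof.
move=> cf b; have [c [K H]] := cf b.
exists (Seq c (Pop (W b))), K.+1 => x st /H[s [run val sz]].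
exists (behead s); split.
- apply: runs_eq (runs_seq run (runs_pop _ _)) _ _.
    by rewrite tmbS leq_add2l tmb_gt0.
  by move=> r; rewrite /update eqxx; case: eqP.
- by rewrite -half_nat_of_bits val.
rewrite size_behead (leq_trans (leq_pred _)) // (leq_trans sz) //.
exact: szb_leq.
Qed.

Lemma computes_if (p : dom D -> bool) f g : computes (fun x => p x) ->
  computes f -> computes g -> computes (fun x => if p x then f x else g x).
Proof.
move=> cp cf cg b; have [c [K H]] := cp b.
have [c1 [K1 H1]] := cf b; have [c2 [K2 H2]] := cg b.
exists (Seq c (Case (W b) c2 (Seq (clear (W b)) c2) (Seq (clear (W b)) c1))).
exists (K + K1 + K2 + (2 * K.+1 + 2)) => x st r.
have [s [run val sz]] := H x st r.
have [s1 [run1 val1 sz1]] := H1 x st r.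
have [s2 [run2 val2 sz2]] := H2 x st r.
exists (if p x then s1 else s2); split; last first.
- by case: (p x); [apply: leq_trans sz1 _|apply: leq_trans sz2 _]; apply: szb_leq; lia.
- by case: (p x).
have p_head : p x = head false s.
  by rewrite -odd_nat_of_bits val oddb.
have run_clear : runs (clear (W b)) (update st (W b) s) (2 * size s + 1) st.
  apply: runs_eq (runs_clear _ _) _ _; rewrite ?updateE // => r'.
  rewrite /update; case: eqP => // ->; by rewrite (ready_free r).
apply: runs_eq (runs_seq run (runs_case (T := 2 * size s + 1 + tmb (K1 + K2) x)
  (st' := update st (W b) (if p x then s1 else s2)) _)) _ _ => //; last first.
  rewrite -!tmbD -tmbM; have := szb_tmb K x; have := tmb_const 2 x; lia.
rewrite updateE p_head; case def_s: s => [|[] s'] /=.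
- rewrite (functional_extensionality _ _ (update_id (ready_free r (leqnn b)))).
  by apply: runs_eq run2 _ _ => //; rewrite -tmbD; lia.
- rewrite -def_s; apply: runs_eq (runs_seq run_clear run1) _ _ => //.
  by rewrite -tmbD def_s /=; lia.
rewrite -def_s; apply: runs_eq (runs_seq run_clear run2) _ _ => //.
by rewrite -tmbD def_s /=; lia.
Qed.

Lemma computes_odd f : computes f -> computes (fun x => odd (f x)).
Proof.
move=> cf b; have [c [K H]] := cf b.
exists (Seq c (Case (W b) Skip (clear (W b)) (Seq (clear (W b)) (Push (W b) true)))).
exists (K + (2 * K.+1 + 3)).+1 => x st r.
have [s [run val sz]] := H x st r.
exists (if head false s then [:: true] else [::]); split; last first.
- case: (s) sz => [|[] ?] //= sz; apply: leq_ltn_trans (szbS _ _); lia.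
- by rewrite -val odd_nat_of_bits; case: (head _ _).
have run_clear : runs (clear (W b)) (update st (W b) s) (2 * size s + 1) st.
  apply: runs_eq (runs_clear _ _) _ _; rewrite ?updateE // => r'.
  rewrite /update; case: eqP => // ->; by rewrite (ready_free r).
apply: runs_eq (runs_seq run (runs_case (T := 2 * size s + 2)
  (st' := update st (W b) (if head false s then [:: true] else [::])) _)) _ _ => //; last first.
  rewrite tmbS -!tmbD -tmbM; have := szb_tmb K x; have := tmb_const 3 x; lia.
have e : st (W b) = [::] by apply: ready_free r _.
rewrite updateE; case def_s: s => [|[] s'] /=.
- by apply: runs_eq (runs_skip _) _ _.
- rewrite -def_s; apply: runs_eq (runs_seq run_clear (runs_push _ _ _)) _ _.
    by rewrite def_s /=; lia.
  by move=> r'; rewrite e.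
rewrite -def_s; apply: runs_eq run_clear _ _; first by rewrite def_s /=; lia.
by move=> r'; rewrite update_id.
Qed.

(** The second operand is evaluated one register above the first result, and the next two registers
    serve as carry and output. A result at most one bit longer than the operands stays in the size
    class by [szbS]. *)
Lemma computes_op (op : R -> R -> R -> R -> cmd R) (F : nat -> nat -> nat) :
  (forall u v s o, uniq [:: u; v; s; o] ->
     forall st, st s = [::] -> st o = [::] -> exists t,
       [/\ runs (op u v s o) st (20 * (size (st u) + size (st v)).+1)
             (update (update st u t) v [::]),
           nat_of_bits t = F (nat_of_bits (st u)) (nat_of_bits (st v))
         & size t <= (maxn (size (st u)) (size (st v))).+1]) ->
  forall f g, computes f -> computes g -> computes (fun x => F (f x) (g x)).
Proof.
move=> Hop f g cf cg b; have [c [K H]] := cf b; have [c1 [K1 H1]] := cg b.+1.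
exists (Seq c (Seq c1 (op (W b) (W b.+1) (W b.+2) (W b.+3)))).
exists (K + K1 + 20 * (K + K1).+3) => x st r.
have [s [run val sz]] := H x st r.
have r1 := ready_update s r.
have [s1 [run1 val1 sz1]] := H1 x _ r1.
have uW : uniq [:: W b; W b.+1; W b.+2; W b.+3].
  by rewrite /= !inE !W_eq; lia.
set st2 := update _ _ s1 in run1.
have e2 : st2 (W b.+2) = [::].
  by apply: ready_free (ready_update s1 r1) _; lia.
have e3 : st2 (W b.+3) = [::].
  by apply: ready_free (ready_update s1 r1) _; lia.
have eb : st2 (W b) = s by rewrite /st2 update_neq ?updateE // W_eq; lia.
have eb1 : st2 (W b.+1) = s1 by rewrite /st2 updateE.
have [t [run2 val2 sz2]] := Hop _ _ _ _ uW _ e2 e3.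
rewrite eb eb1 in run2 val2 sz2.
exists t; split; last first.
- apply: leq_trans sz2 _.
  have := szb_leq x (leq_addr K1 K); have := szb_leq x (leq_addl K K1).
  have : szb (K + K1).+1 x <= szb (K + K1 + 20 * (K + K1).+3) x.
    by apply: szb_leq; lia.
  by have := szbS (K + K1) x; lia.
- by rewrite val2 val val1.
apply: runs_eq (runs_seq run (runs_seq run1 run2)) _ _.
  have -> : (K + K1).+3 = K.+1 + K1.+1 + 1 by rewrite addn1 addSn addnS.
  rewrite -!tmbD -tmbM -!tmbD.
  have := szb_tmb K x; have := szb_tmb K1 x; have := tmb_gt0 x.
  lia.
move=> r'; rewrite /st2 /update.
case: (r' =P W b.+1) => [->|_]; last by case: (r' =P W b).
by rewrite W_eq (gtn_eqF (ltnSn b)) (ready_free r).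
Qed.

Lemma computes_add f g : computes f -> computes g -> computes (fun x => f x + g x).
Proof.
apply: (computes_op (op := @add_op R)) => u v s o uW st es eo.
by have [t [run val sz]] := runs_add uW es eo; exists t; rewrite sz.
Qed.

Lemma computes_sub f g : computes f -> computes g -> computes (fun x => f x - g x).
Proof.
apply: (computes_op (op := @sub_op R)) => u v s o uW st es eo.
by have [t [run val sz]] := runs_sub uW es eo; exists t; rewrite ltnW.
Qed.

Lemma computes_ltn f g : computes f -> computes g -> computes (fun x => f x < g x).
Proof.
apply: (computes_op (op := @ltn_op R) (F := fun a b => a < b)) => u v s o uW st es eo.
by have [t [run val sz]] := runs_ltn uW es eo; exists t; rewrite sz.
Qed.

Fixpoint fill st b l (s : nat -> seq bool) : store R :=
  if l is l'.+1 then update (fill st b l' s) (W (b + l')) (s l') else st.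

Lemma fill_in st b l s j : j < l -> fill st b l s (W (b + j)) = s j.
Proof.
elim: l => // l IH; rewrite ltnS leq_eqVlt /= => /orP[/eqP->|lt]; first by rewrite updateE.
by rewrite update_neq ?IH // W_eq eqn_add2l ltn_eqF.
Qed.

Lemma fill_out st b l s r : (forall j, j < l -> r != W (b + j)) ->
  fill st b l s r = st r.
Proof.
elim: l => //= l IH out; rewrite update_neq ?IH // => [j lt|]; first exact/out/ltnW.
exact: out.
Qed.

Lemma fill_ext st b l s s' : (forall j, j < l -> s j = s' j) ->
  fill st b l s = fill st b l s'.
Proof.
elim: l => //= l IH eq_s; rewrite IH ?eq_s // => j lt; exact/eq_s/ltnW.
Qed.

(** The results pile up while the inputs remain intact, as a simultaneous update of loop variables
    requires. *)
Lemma computes_seq (F : nat -> dom D -> nat) l :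
  (forall j, j < l -> computes (F j)) -> forall b, exists c K, forall x st,
    ready x b st -> exists s, [/\ runs c st (tmb K x) (fill st b l s),
      forall j, j < l -> nat_of_bits (s j) = F j x /\ size (s j) <= szb K x
      & ready x (b + l) (fill st b l s)].
Proof.
elim: l => [|l IH] cF b.
  exists Skip, 1 => x st r; exists (fun=> [::]); split; rewrite ?addn0 //.
  exact: runs_eq (runs_skip _) (tmb_gt0 _) _.
have [j lt|c1 [K1 H1]] := IH _ b; first exact/cF/ltnW.
have [c2 [K2 H2]] := cF l (leqnn _) (b + l).
exists (Seq c1 c2), (K1 + K2) => x st r.
have [s [run1 vals r1]] := H1 x st r.
have [t [run2 val2 sz2]] := H2 _ _ r1.
pose s' j := if j == l then t else s j.
have fill_s : fill st b l s = fill st b l s'.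
  by apply: fill_ext => j lt; rewrite /s' ltn_eqF.
exists s'; split => /=.
- rewrite -tmbD -fill_s /s' eqxx; exact: runs_seq run1 run2.
- move=> j; rewrite ltnS /s'; case: eqP => [-> _|/eqP ne le_j].
    by rewrite val2 (leq_trans sz2) // szb_leq // leq_addl.
  have [|-> le_s] := vals j; first by rewrite ltn_neqAle ne.
  by rewrite (leq_trans le_s) // szb_leq // leq_addr.
rewrite addnS -fill_s; exact: ready_update.
Qed.

End Closure.

(** * Linear time, for the bodies of loops *)

Section Linear.

Variables (b0 k : nat).

Definition lin_ready (x : nat * (nat -> nat)) b (st : store R) := [/\ b0 + k <= b,
  forall j, j < k -> nat_of_bits (st (W (b0 + j))) = x.2 j /\ size (st (W (b0 + j))) <= x.1
  & forall i, b <= i -> st (W i) = [::]].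

(** Sizes are bounded by [x.1 + K], additively: evaluating a loop body lengthens its variables by
    O(1) bits only. *)
Definition linear : setting.
Proof.
apply: (@Setting _ lin_ready (fun K x => x.1 + K) (fun K x => K * x.1.+1)).
- by move=> x b st i [_ _]; apply.
- move=> x b st s [le_b vals free]; split; first exact: leqW.
    by move=> j lt; rewrite update_neq; [exact: vals|rewrite W_eq; lia].
  by move=> i lt; rewrite update_neq ?free 1?ltnW // W_eq gtn_eqF.
- by move=> K x; rewrite ltn_add2l.
- by move=> x; rewrite mul1n.
- by move=> K K' x; rewrite mulnDl.
by move=> K x; rewrite mulnS; lia.
Defined.

Lemma linear_var j : j < k -> computes (D := linear) (fun x => x.2 j).
Proof.
move=> lt_j b; exists (copy (W (b0 + j)) (W b) (W b.+1)), 9 => -[B e] st.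
move=> [le_b vals free]; have [val sz] := vals j lt_j; rewrite /= in val sz.
exists (st (W (b0 + j))); split => //=; last by lia.
have [fb fb1] : st (W b) = [::] /\ st (W b.+1) = [::] by rewrite !free.
by apply: runs_eq (runs_copy _ _ _ fb1 fb) _ _; rewrite ?W_eq //=; lia.
Qed.

End Linear.

(** * Quadratic time, and loops driven by the clock *)

Section Quadratic.

Variables (X : Type) (inp : X -> store R) (is_input : pred R) (N : X -> nat).
Hypothesis N_gt0 : forall x, 0 < N x.
Hypothesis W_input : forall k, ~~ is_input (W k).

(* The unary register [W 0] serves as a clock for the loops. *)
Definition quad_ready x b (st : store R) := [/\ 0 < b,
  forall r, is_input r -> st r = inp x r, st (W 0) = nseq (N x) true
  & forall i, b <= i -> st (W i) = [::]].

(** Here the factor [K] of the sizes may grow at each composition; it stays bounded because a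
    program contains a fixed number of compositions. *)
Definition quadratic : setting.
Proof.
apply: (@Setting _ quad_ready (fun K x => K * N x) (fun K x => K * N x ^ 2)).
- by move=> x b st i [_ _ _]; apply.
- move=> x b st s [b_gt0 eq_in clock free]; split => // [r in_r||i lt].
  + rewrite update_neq ?eq_in //; apply: contraL in_r => /eqP->; exact: W_input.
  + by rewrite update_neq // W_eq; lia.
  by rewrite update_neq ?free 1?ltnW // W_eq gtn_eqF.
- by move=> K x; rewrite ltn_pmul2r.
- by move=> x; rewrite mul1n expn_gt0 N_gt0.
- by move=> K K' x; rewrite mulnDl.
by move=> K x; have := N_gt0 x; rewrite mulSn expnS expn1 mulnA; nia.
Defined.

Definition quad_computes f := computes (D := quadratic) f.

Lemma quad_input r : is_input r -> (forall x, size (inp x r) <= N x) ->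
  quad_computes (fun x => nat_of_bits (inp x r)).
Proof.
move=> in_r sz b; exists (copy r (W b) (W b.+1)), 11 => x st.
move=> [b_gt0 eq_in clock free]; have nW i : r != W i.
  by apply: contraL in_r => /eqP->; exact: W_input.
exists (inp x r); split => //=; last by have := sz x; lia.
have [fb fb1] : st (W b) = [::] /\ st (W b.+1) = [::] by rewrite !free.
apply: runs_eq (runs_copy _ _ _ fb1 fb) _ _; rewrite ?nW ?W_eq //=; first lia.
  by rewrite eq_in //; have := sz x; have := N_gt0 x; nia.
by move=> r'; rewrite eq_in.
Qed.

Definition holds b k (e : nat -> nat) B (st : store R) := forall j, j < k ->
  nat_of_bits (st (W (b + j))) = e j /\ size (st (W (b + j))) <= B.

Fixpoint transfer b b' t l : cmd R :=
  if l is l'.+1 then Seq (transfer b b' t l')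
    (Seq (clear (W (b + l'))) (move (W (b' + l')) (W (b + l')) (W t)))
  else Skip.

Lemma runs_transfer b b' t l st B :
    b + l <= b' -> b' + l <= t -> st (W t) = [::] ->
    (forall j, j < l -> size (st (W (b + j))) <= B /\ size (st (W (b' + j))) <= B) ->
  exists st', [/\ runs (transfer b b' t l) st (l * (10 * B + 3) + 1) st',
    forall j, j < l -> st' (W (b + j)) = st (W (b' + j)),
    forall j, j < l -> st' (W (b' + j)) = [::]
    & forall r, (forall j, j < l -> r != W (b + j) /\ r != W (b' + j)) -> st' r = st r].
Proof.
move=> + + et; elim: l => [|l IH] le_b le_b' sz.
  by exists st; split=> //; apply: runs_skip.
have [||j lt|st1 [run1 new old out]] := IH _ _; [lia|lia|exact/sz/ltnW|].
have Wne i j : i != j -> W i != W j by rewrite W_eq.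
have e1 : st1 (W (b + l)) = st (W (b + l)).
  by apply: out => j lt; split; apply: Wne; lia.
have e2 : st1 (W (b' + l)) = st (W (b' + l)).
  by apply: out => j lt; split; apply: Wne; lia.
have e3 : st1 (W t) = [::].
  by rewrite -et; apply: out => j lt; split; apply: Wne; lia.
have [sz1 sz2] := sz l (leqnn _).
have run2 := runs_clear (W (b + l)) st1.
set st2 := update _ _ _ in run2.
have t2 : st2 (W t) = [::] by rewrite /st2 update_neq // Wne //; lia.
have [d1 d2 d3] : [/\ W (b' + l) != W (b + l), W (b' + l) != W t & W (b + l) != W t].
  by split; apply: Wne; lia.
have run3 := runs_move d1 d2 d3 t2.
have b2 : st2 (W (b + l)) = [::] by rewrite /st2 updateE.
have b2' : st2 (W (b' + l)) = st (W (b' + l)) by rewrite /st2 update_neq.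
rewrite b2 b2' cats0 in run3; set st3 := update _ _ _ in run3.
exists st3; split.
- apply: runs_eq (runs_seq run1 (runs_seq run2 run3)) _ _ => //.
  by rewrite e1; move: sz1 sz2; clear; lia.
- move=> j; rewrite ltnS leq_eqVlt => /orP[/eqP->|lt].
    by rewrite /st3 update_neq ?updateE // eq_sym.
  by rewrite /st3 /st2 !update_neq ?new //; apply: Wne; lia.
- move=> j; rewrite ltnS leq_eqVlt => /orP[/eqP->|lt].
    by rewrite /st3 updateE.
  by rewrite /st3 /st2 !update_neq ?old //; apply: Wne; lia.
move=> r r_out; have [o1 o2] := r_out l (leqnn _).
by rewrite /st3 /st2 !update_neq // out // => j /ltnW; apply: r_out.
Qed.

Fixpoint clear_all b l : cmd R :=
  if l is l'.+1 then Seq (clear_all b l') (clear (W (b + l'))) else Skip.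

Lemma runs_clear_all b l st B : (forall j, j < l -> size (st (W (b + j))) <= B) ->
  exists st', [/\ runs (clear_all b l) st (l * (2 * B + 1) + 1) st',
    forall j, j < l -> st' (W (b + j)) = [::]
    & forall r, (forall j, j < l -> r != W (b + j)) -> st' r = st r].
Proof.
elim: l => [|l IH] sz; first by exists st; split=> //; apply: runs_skip.
have [j lt|st1 [run1 new out]] := IH _; first exact/sz/ltnW.
have e1 : st1 (W (b + l)) = st (W (b + l)).
  by apply: out => j lt; rewrite W_eq; lia.
exists (update st1 (W (b + l)) [::]); split.
- apply: runs_eq (runs_seq run1 (runs_clear _ _)) _ _ => //.
  by rewrite e1; have := sz l (leqnn _); clear; lia.
- move=> j; rewrite ltnS leq_eqVlt => /orP[/eqP->|lt]; first by rewrite updateE.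
  by rewrite update_neq ?new // W_eq; lia.
move=> r r_out; rewrite update_neq ?out ?r_out // => j /ltnW; exact: r_out.
Qed.

Section Iterate.

Variables (k : nat) (step : (nat -> nat) -> nat -> nat).
Hypothesis lin_step : forall b0 j, j < k ->
  computes (D := linear b0 k) (fun x => step x.2 j).

(** The new values are built above [W (b + k)], which is left to the loop counter, and replace the
    old ones only when all are complete. *)
Lemma runs_step b : exists c K, forall st e B, holds b k e B st ->
    (forall i, b + k < i -> st (W i) = [::]) ->
  exists st', [/\ runs c st (K * B.+1) st', holds b k (step e) (B + K) st'
    & forall r, (forall j, j < k -> r != W (b + j)) -> st' r = st r].
Proof.
have [c [K H]] := computes_seq (@lin_step b) (b + k).+1.
pose t := (b + k).+1 + k.
exists (Seq c (transfer b (b + k).+1 t k)), (K + k * (10 * K + 13) + 1).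
move=> st e B hold free.
have rdy : @ready (linear b k) (B, e) (b + k).+1 st by split.
have [s [run1 vals _]] := H _ _ rdy.
have Wne i j : i != j -> W i != W j by rewrite W_eq.
set st1 := fill _ _ _ _ in run1.
have st1_new j : j < k -> st1 (W ((b + k).+1 + j)) = s j by exact: fill_in.
have st1_old j : j < k -> st1 (W (b + j)) = st (W (b + j)).
  by move=> lt; apply: fill_out => i lt_i; apply: Wne; lia.
have st1_t : st1 (W t) = [::].
  rewrite /st1 fill_out ?free => // [|i lt_i]; first by rewrite /t; lia.
  by apply: Wne; rewrite /t; lia.
have le_b : b + k <= (b + k).+1 by [].
have [j lt|st2 [run2 new old out]] :=
  runs_transfer (B := B + K) le_b (leqnn t) st1_t.
  rewrite st1_old // st1_new //; have [_ sz] := hold j lt; have [_ sz'] := vals j lt.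
  by split=> //; apply: leq_trans sz (leq_addr _ _).
exists st2; split.
- apply: runs_eq (runs_seq run1 run2) _ _ => //=.
  have : 10 * (B + K) + 3 <= (10 * K + 13) * B.+1 by clear; nia.
  by move=> /(leq_mul (leqnn k)); rewrite mulnA !mulnDl; clear; lia.
- move=> j lt; rewrite new // st1_new //; have [-> sz] := vals j lt.
  by split=> //; rewrite (leq_trans sz) //= leq_add2l -addnA leq_addr.
move=> r r_out.
have [/existsP[j /eqP->]|/existsPn no] :=
  boolP [exists j : 'I_k, r == W ((b + k).+1 + j)].
  by rewrite old ?free ?ltn_ord //; lia.
have no' j (lt : j < k) : r != W ((b + k).+1 + j) by exact: (no (Ordinal lt)).
rewrite out => [|j lt]; first by rewrite /st1 fill_out.
by split; [apply: r_out|apply: no'].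
Qed.

(** The variables gain at most [t * K] bits in [t] rounds; every round is charged at this final
    size. *)
Lemma runs_loop b : exists c K, forall t st e B,
    st (W (b + k)) = nseq t true -> holds b k e B st ->
    (forall i, b + k < i -> st (W i) = [::]) ->
  exists st', [/\ runs c st (t * (K * (B + t * K).+1 + 2) + 1) st',
    holds b k (iter t step e) (B + t * K) st', st' (W (b + k)) = [::]
    & forall r, (forall j, j <= k -> r != W (b + j)) -> st' r = st r].
Proof.
have [c [K H]] := runs_step b.
exists (While (W (b + k)) (Seq (Pop (W (b + k))) c)), K.
have Wne i j : i != j -> W i != W j by rewrite W_eq.
elim=> [|t IH] st e B clock hold free.
  exists st; split => //; first exact: runs_while_stop.
  by rewrite addn0.
pose st1 := update st (W (b + k)) (nseq t true).
have hold1 : holds b k e B st1.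
  by move=> j lt; rewrite /st1 update_neq; [exact: hold|apply: Wne; lia].
have free1 i : b + k < i -> st1 (W i) = [::].
  by move=> lt; rewrite /st1 update_neq ?free //; apply: Wne; lia.
have [st2 [run2 hold2 out2]] := H _ _ _ hold1 free1.
have clock2 : st2 (W (b + k)) = nseq t true.
  by rewrite out2 => [|j lt]; [rewrite /st1 updateE|apply: Wne; lia].
have free2 i : b + k < i -> st2 (W i) = [::].
  by move=> lt; rewrite out2 ?free1 // => j lt_j; apply: Wne; lia.
have [st3 [run3 hold3 clock3 out3]] := IH _ _ _ clock2 hold2 free2.
have pop : runs (Pop (W (b + k))) st 1 st1.
  by apply: runs_eq (runs_pop _ _) _ _ => // r; rewrite clock.
have ne : st (W (b + k)) <> [::] by rewrite clock.
exists st3; split => //.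
- apply: runs_eq (runs_while_step ne (runs_seq pop run2) run3) _ _ => //.
  have -> : B + K + t * K = B + t.+1 * K by rewrite mulSn addnA.
  have : K * B.+1 <= K * (B + t.+1 * K).+1 by rewrite leq_mul2l ltnS leq_addr orbT.
  by rewrite [t.+1 * (_ + 2)]mulSn; clear; lia.
- by rewrite iterSr mulSn addnA.
move=> r r_out; rewrite out3 // out2 => [|j lt]; last exact/r_out/ltnW.
by rewrite /st1 update_neq // r_out.
Qed.

(** Initial sizes and number of rounds are both O([N x]), so each of the [N x] rounds has linear
    cost. *)
Lemma quad_iter (init : nat -> X -> nat) : (forall j, j < k -> quad_computes (init j)) ->
  forall j, j < k -> quad_computes (fun x => iter (N x) step (fun i => init i x) j).
Proof.
move=> q_init j lt_j b.
have [c0 [K0 H0]] := computes_seq q_init b.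
have [c1 [K1 H1]] := runs_loop b.
pose t := (b + k).+1.
(* The counter [W (b + k)] is empty after the loop; it keeps the selected result while the loop
   variables, [W b] among them, are cleared. *)
exists (Seq c0 (Seq (copy (W 0) (W (b + k)) (W t)) (Seq c1
  (Seq (move (W (b + j)) (W (b + k)) (W t)) (Seq (clear_all b k)
    (move (W (b + k)) (W b) (W t))))))).
pose K2 := K0 + K1.
exists (K0 + 11 + (K1 * K2.+1 + 3) + (8 * K2 + 2) + (k * (2 * K2 + 1) + 1) + (8 * K2 + 2)).
move=> x st rdy; have [s [run0 vals rdy0]] := H0 x st rdy.
set st0 := fill _ _ _ _ in run0 rdy0.
have Wne i i' : i != i' -> W i != W i' by rewrite W_eq.
have [b_gt0 in0 clock0 free0] := rdy0.
have [bk_gt0 bt0] : 0 < b /\ b + k < t by have [] := rdy; rewrite /t.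
have [d1 d2 d3] : [/\ W 0 != W (b + k), W 0 != W t & W (b + k) != W t].
  by split; apply: Wne; lia.
have run1 := runs_copy d1 d2 d3 (free0 t (ltnW bt0)) (free0 _ (leqnn _)).
set st1 := update _ _ _ in run1.
have hold1 : holds b k (fun i => init i x) (K0 * N x) st1.
  move=> i lt; rewrite /st1 update_neq; last by apply: Wne; lia.
  by rewrite /st0 fill_in //; exact: vals.
have clock1 : st1 (W (b + k)) = nseq (N x) true by rewrite /st1 updateE.
have free1 i : b + k < i -> st1 (W i) = [::].
  by move=> lt; rewrite /st1 update_neq ?free0 1?ltnW //; apply: Wne; lia.
have [st2 [run2 hold2 clock2 out2]] := H1 _ _ _ _ clock1 hold1 free1.
have eK2 : K0 * N x + N x * K1 = K2 * N x by rewrite mulnC -mulnDr mulnC.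
rewrite eK2 in run2 hold2; have [val2 sz2] := hold2 j lt_j.
have free2 i : b + k < i -> st2 (W i) = [::].
  by move=> lt; rewrite out2 ?free1 // => i' le; apply: Wne; lia.
have [d4 d5] : W (b + j) != W (b + k) /\ W (b + j) != W t by split; apply: Wne; lia.
have run3 := runs_move d4 d5 d3 (free2 _ bt0).
rewrite clock2 cats0 in run3.
set v := st2 (W (b + j)) in run3 val2 sz2; set st3 := update _ _ _ in run3.
have hold3 i : i < k -> size (st3 (W (b + i))) <= K2 * N x.
  move=> lt; rewrite /st3 /update; case: eqP => // _.
  by rewrite W_eq ifN; [have [] := hold2 i lt|lia].
have [st4 [run4 new4 out4]] := runs_clear_all hold3.
have bk4 : st4 (W (b + k)) = v.
  rewrite out4 => [|i lt]; last by apply: Wne; lia.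
  by rewrite /st3 update_neq 1?eq_sym // updateE.
have t4 : st4 (W t) = [::].
  rewrite out4 => [|i lt]; last by apply: Wne; lia.
  by rewrite /st3 !update_neq ?free2 // eq_sym.
have b4 : st4 (W b) = [::].
  by rewrite -[b in W b]addn0 new4 //; apply: leq_trans lt_j.
have [d6 d7] : W (b + k) != W b /\ W b != W t by split; apply: Wne; lia.
have run5 := runs_move d6 d3 d7 t4; rewrite b4 bk4 cats0 in run5.
exists v; split => //; last first.
  by rewrite (leq_trans sz2) // leq_mul2r /K2; apply/orP; right; clear; lia.
apply: runs_eq (runs_seq run0 (runs_seq run1 (runs_seq run2 (runs_seq run3
  (runs_seq run4 run5))))) _ _.
  rewrite clock0 size_nseq /= !mulnDl.
  have N2 : N x <= N x ^ 2 by rewrite expnS expn1 leq_pmulr.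
  have N1 : 0 < N x ^ 2 by rewrite expn_gt0 N_gt0.
  have mulN2 a : a * N x <= a * N x ^ 2 by rewrite leq_mul2l N2 orbT.
  have := mulN2 9; have := mulN2 (8 * K2); have := mulN2 (k * (2 * K2)).
  have : N x * (K1 * (K2 * N x).+1 + 2) <= K1 * K2.+1 * N x ^ 2 + 2 * N x ^ 2.
    have : N x * (K1 * K2 * N x) = K1 * K2 * N x ^ 2 by rewrite expnS expn1; clear; nia.
    by have := mulN2 K1; have := mulN2 2; clear; nia.
  have := mulN2 k.
  move: sz2 N2 N1; move: (N x ^ 2) (N x) (size v) (K1 * _ * _) => N2 N1 z a.
  by clear; nia.
move=> r; rewrite /update.
have [/existsP[i /eqP->]|/existsPn no] := boolP [exists i : 'I_k, r == W (b + i)].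
  rewrite W_eq ifN; last by have := ltn_ord i; lia.
  by rewrite new4 // (ready_free rdy) ?leq_addr.
have no' i : i < k -> r != W (b + i) by move=> lt; apply: (no (Ordinal lt)).
have [->|ne_bk] := eqVneq r (W (b + k)).
  by rewrite W_eq ifN ?(ready_free rdy) ?leq_addr //; lia.
have -> : (r == W b) = false.
  by apply/negbTE; rewrite -[b]addn0 no' //; apply: leq_trans lt_j.
rewrite out4 // /st3 update_neq ?no' // update_neq //.
rewrite out2 => [|i]; last first.
  by rewrite leq_eqVlt => /orP[/eqP->|/no'].
by rewrite /st1 update_neq // /st0 fill_out.
Qed.

End Iterate.

End Quadratic.

End Computable.

(** * Arithmetic in quadratic time *)

Section Congruences.

Lemma eqn_mod_half q a b : odd q -> a.*2 = b.*2 %[mod q] -> a = b %[mod q].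
Proof.
move=> odd_q; wlog le : a b / b <= a => [H e|].
  by have [/H->|/ltnW/H->] := leqP b a.
move=> /eqP; rewrite eqn_mod_dvd ?leq_double // -doubleB -mul2n Gauss_dvdr ?coprimen2 //.
by rewrite -eqn_mod_dvd // => /eqP.
Qed.

Lemma eqn_mod_lcm p q a b : a = b %[mod p] -> a = b %[mod q] -> a = b %[mod lcmn p q].
Proof.
wlog le : a b / b <= a => [H e1 e2|].
  by have [/H->|/ltnW/H->] := leqP b a.
by move=> /eqP + /eqP; rewrite !eqn_mod_dvd // => e1 e2; apply/eqP; rewrite eqn_mod_dvd // dvdn_lcm e1.
Qed.

Lemma eqn_mod_dvdn d q a b : d %| q -> a = b %[mod q] -> a = b %[mod d].
Proof. by move=> dq e; rewrite -(modn_dvdm a dq) e modn_dvdm. Qed.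

Lemma gcdn_half a b : odd b -> ~~ odd a -> gcdn a./2 b = gcdn a b.
Proof.
move=> odd_b even_a; rewrite -{2}[a]even_halfK // -mul2n gcdnC [RHS]gcdnC.
by rewrite Gauss_gcdr // coprimen2.
Qed.

Lemma gcdn_subl a b : b <= a -> gcdn (a - b) b = gcdn a b.
Proof. by move=> le; rewrite -{2}(subnK le) gcdnC [RHS]gcdnC gcdnDr. Qed.

(** The term [a1 * (p2 - 1)] is a natural number congruent to [- a1] modulo [p2]. The common
    solution [z] makes the gcd divide the difference of the two residues, and modulo [p2] the factor
    [u * p1] undoes the division. *)
Lemma crt_formula a1 p1 a2 p2 u z : 0 < p1 -> 0 < p2 ->
    u * p1 = gcdn p1 p2 %[mod p2] -> z = a1 %[mod p1] -> z = a2 %[mod p2] ->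
  (a1 + p1 * (u * ((a2 + a1 * (p2 - 1)) %/ gcdn p1 p2))) %% lcmn p1 p2 =
  z %% lcmn p1 p2.
Proof.
move=> p1_gt0 p2_gt0; set G := gcdn _ _; set T := a2 + _ => eu e1 e2.
have G_T : G %| T.
  have eG : a1 = a2 %[mod G].
    rewrite -(eqn_mod_dvdn (dvdn_gcdl p1 p2) e1).
    by rewrite -(eqn_mod_dvdn (dvdn_gcdr p1 p2) e2).
  have : T + 0 = 0 %[mod G].
    rewrite addn0 /T -modnDml -eG modnDml -mulnS subn1 prednK //.
    by rewrite -(divnK (dvdn_gcdr p1 p2)) mulnA modnMl mod0n.
  by rewrite addn0 mod0n => /eqP.
apply: eqn_mod_lcm; first by rewrite mulnC addnC modnMDl e1.
rewrite mulnA [p1 * u]mulnC -modnDmr -modnMml eu modnMml modnDmr.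
rewrite [G * _]mulnC divnK // /T addnCA -mulnS subn1 prednK //.
by rewrite addnC modnMDl e2.
Qed.

End Congruences.

(** * The binary extended Euclidean algorithm *)

Section BinaryGcd.

(** Division by 2 modulo an odd [q]. Representatives up to [q] inclusive are enough: the cofactors
    matter only modulo [q] and must merely not grow. *)
Definition half_mod q u := if odd u then (u + q)./2 else u./2.
Definition sub_mod q u v := if u < v then u + q - v else u - v.

Lemma half_mod_leq q u : u <= q -> half_mod q u <= q.
Proof. by rewrite /half_mod; case: odd; lia. Qed.

Lemma sub_mod_leq q u v : u <= q -> sub_mod q u v <= q.
Proof. by rewrite /sub_mod; case: ltnP; lia. Qed.

Lemma half_modE q u : odd q -> (half_mod q u).*2 = u %[mod q].
Proof.
move=> odd_q; rewrite /half_mod; case: ifPn => odd_u; last by rewrite even_halfK.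
by rewrite even_halfK ?oddD ?odd_u ?odd_q // modnDr.
Qed.

Lemma sub_modE q u v : v <= q -> sub_mod q u v + v = u %[mod q].
Proof.
by move=> le; rewrite /sub_mod; case: ltnP => lt; rewrite subnK ?modnDr //; lia.
Qed.

(* State: [a], [b], [u], [v] and the odd modulus [q], with [a = u p] and
   [b = v p] modulo [q], and [b] odd. *)
Definition bezout_step (e : nat -> nat) := nth 0
  [:: if odd (e 0) then if e 0 < e 1 then (e 1 - e 0)./2 else (e 0 - e 1)./2
      else (e 0)./2;
      if odd (e 0) then if e 0 < e 1 then e 0 else e 1 else e 1;
      if odd (e 0) then
        if e 0 < e 1 then half_mod (e 4) (sub_mod (e 4) (e 3) (e 2))
        else half_mod (e 4) (sub_mod (e 4) (e 2) (e 3))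
      else half_mod (e 4) (e 2);
      if odd (e 0) then if e 0 < e 1 then e 2 else e 3 else e 3;
      e 4].

Definition bezout_inv p q (e : nat -> nat) := [/\ e 4 = q,
  odd (e 1), gcdn (e 0) (e 1) = gcdn p q, e 2 <= q /\ e 3 <= q
  & e 0 = e 2 * p %[mod q] /\ e 1 = e 3 * p %[mod q]].

(** An even [a], or else the even difference of the two odd numbers, is halved; the gcd survives
    because the other number is odd. The product [e 0 * e 1] measures progress, losing a factor of
    at least 2 per round. *)
Lemma bezout_step_inv p q e : odd q -> bezout_inv p q e ->
  bezout_inv p q (bezout_step e) /\
  (bezout_step e 0 * bezout_step e 1).*2 <= e 0 * e 1.
Proof.
move=> odd_q [def_q odd_b eG [le_u le_v] [eu ev]].
have halfE a w : ~~ odd a -> a = w * p %[mod q] -> a./2 = half_mod q w * p %[mod q].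
  move=> even_a ea; apply: (eqn_mod_half odd_q).
  by rewrite even_halfK // ea -mul2n mulnA mul2n -[in RHS]modnMml half_modE // modnMml.
have subE a b w z : b <= a -> z <= q -> a = w * p %[mod q] -> b = z * p %[mod q] ->
    a - b = sub_mod q w z * p %[mod q].
  move=> le le_z ea eb; apply/eqP; rewrite -(eqn_modDr b) subnK // ea.
  by rewrite -modnDmr eb modnDmr -mulnDl -[in eqbRHS]modnMml sub_modE // modnMml.
rewrite /bezout_inv; cbv [bezout_step nth]; rewrite def_q.
case: ifPn => odd_a; last first.
  split; last by rewrite -muln2 mulnAC muln2 even_halfK.
  split=> //; first by rewrite (gcdn_half odd_b odd_a).
    by rewrite half_mod_leq.
  by split=> //; apply: halfE.
case: ltnP => lt.
  have even : ~~ odd (e 1 - e 0) by rewrite oddB ?odd_a ?odd_b // ltnW.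
  split.
    split; rewrite ?half_mod_leq ?sub_mod_leq //; first last.
    - by split=> //; apply: halfE => //; apply: subE => //; apply: ltnW.
    rewrite (gcdn_half odd_a even) (gcdn_subl (ltnW lt)) gcdnC; exact: eG.
  by rewrite -muln2 mulnAC muln2 even_halfK // mulnC leq_mul2l leq_subr orbT.
have even : ~~ odd (e 0 - e 1) by rewrite oddB ?odd_a ?odd_b.
split.
  split; rewrite ?half_mod_leq ?sub_mod_leq //; first last.
  - by split=> //; apply: halfE => //; apply: subE.
  rewrite (gcdn_half odd_b even) (gcdn_subl lt); exact: eG.
by rewrite -muln2 mulnAC muln2 even_halfK // leq_mul2r leq_subr orbT.
Qed.

(** The product of the two numbers has become 0 after [t] rounds; [b] is odd, so [a] vanished and
    [b] is the gcd. *)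
Lemma bezout_stepE p q t : odd q -> p * q < 2 ^ t ->
  let e := iter t bezout_step (nth 0 [:: p; q; 1; 0; q]) in
  e 1 = gcdn p q /\ e 3 * p = gcdn p q %[mod q].
Proof.
move=> odd_q lt_t; set e0 := nth 0 _.
have inv0 : bezout_inv p q e0.
  by split=> //; split=> //=; rewrite ?odd_gt0 ?mul1n // mul0n modnn mod0n.
have {inv0} inv k : bezout_inv p q (iter k bezout_step e0) /\
    iter k bezout_step e0 0 * iter k bezout_step e0 1 * 2 ^ k <= p * q.
  elim: k => [|k [IH le]]; first by rewrite muln1.
  have [inv' le'] := bezout_step_inv odd_q IH; split=> //.
  apply: leq_trans le; rewrite iterS expnS mulnA leq_mul2r muln2 le'.
  exact: orbT.
have [[e4 odd_b eG _ [_ ev]] le] := inv t; rewrite /=.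
move: (iter t _ _) e4 odd_b eG ev le => e _ odd_b eG ev le.
have : e 0 * e 1 == 0 by have := leq_ltn_trans le lt_t; rewrite -{2}[2 ^ t]mul1n ltn_mul2r; lia.
rewrite muln_eq0 => /orP[/eqP e0'|/eqP e1']; last by rewrite e1' in odd_b.
by move: eG; rewrite e0' gcd0n => <-.
Qed.

Definition strip_step (e : nat -> nat) := nth 0
  [:: if odd (e 0) then e 0 else if odd (e 1) then e 0 else (e 0)./2;
      if odd (e 0) then e 1 else if odd (e 1) then e 1 else (e 1)./2;
      if odd (e 0) then e 2 else if odd (e 1) then e 2 else (e 2).*2].

(** If both numbers were still even, each of the [t] rounds would have removed a factor of 2, and
    [2 ^ t] would divide the smaller positive [p]. *)
Lemma strip_stepE p q t : 0 < p -> p < 2 ^ t ->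
  let e := iter t strip_step (nth 0 [:: p; q; 1]) in
  [/\ p = e 0 * e 2, q = e 1 * e 2 & odd (e 0) || odd (e 1)].
Proof.
move=> p_gt0 lt_t; set e0 := nth 0 _.
have inv k : let e := iter k strip_step e0 in [/\ p = e 0 * e 2, q = e 1 * e 2
    & odd (e 0) || odd (e 1) || (e 2 == 2 ^ k)].
  elim: k => [|k /= []]; first by rewrite /= !muln1 eqxx orbT.
  move: (iter k _ _) => e; cbv [strip_step nth].
  case: ifPn => odd0 e1 e2 /=; first by rewrite odd0.
  case: ifPn => odd1 /=; first by rewrite odd1 orbT.
  move=> /eqP e3; rewrite -!doubleMr !doubleMl !even_halfK //; split=> //.
  by rewrite e3 -mul2n -expnS eqxx orbT.
rewrite /=; have [e1 e2 /orP[//|/eqP e3]] := inv t; split=> //.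
move: (iter t _ _) e1 e3 => e e1 e3; rewrite e3 in e1.
move: lt_t p_gt0; rewrite {}e1 muln_gt0 => + /andP[e_gt0 _].
by rewrite -{2}[2 ^ t]mul1n ltn_mul2r => /andP[_]; rewrite ltnNge e_gt0.
Qed.

End BinaryGcd.

(** * Multiplication, division, gcd and Chinese remainders on the machine *)

Section Arithmetic.

Variables (R : eqType) (W : nat -> R) (W_inj : injective W).
Variables (X : Type) (inp : X -> store R) (is_input : pred R) (N : X -> nat).
Hypothesis N_gt0 : forall x, 0 < N x.
Hypothesis W_input : forall k, ~~ is_input (W k).

Local Notation quad := (@quad_computes R W W_inj X inp is_input N N_gt0 W_input).
Local Notation quadb p := (quad (fun x => nat_of_bool (p x))).

Ltac linear_tac := lazymatch goal with
  | |- computes (fun x => if _ then _ else _) => apply: computes_if; linear_tac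
  | |- computes (fun x => nat_of_bool (odd (@?f x))) =>
      apply: (@computes_odd _ _ _ f); linear_tac
  | |- computes (fun x => nat_of_bool (@?f x < @?g x)) =>
      apply: (@computes_ltn _ _ W_inj _ f g); linear_tac
  | |- computes (fun x => @?f x + @?g x) =>
      apply: (@computes_add _ _ W_inj _ f g); linear_tac
  | |- computes (fun x => @?f x - @?g x) =>
      apply: (@computes_sub _ _ W_inj _ f g); linear_tac
  | |- computes (fun x => (@?f x)./2) => apply: (@computes_half _ _ _ f); linear_tac
  | |- computes (fun x => (@?f x).*2) => apply: (@computes_double _ _ _ f); linear_tac
  | |- computes (fun x => x.2 ?j) => exact: (@linear_var _ _ W_inj)
  | |- computes (fun _ => ?k) => exact: computes_const
  end.

(** A result has O([N x]) bits, as seen by applying the specification to a concrete store that is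
    ready at height 1. The exponent tells how many rounds later loops need. *)
Lemma quad_bound f : quad f -> exists c, forall x, f x < 2 ^ (c * N x).
Proof.
move=> qf; have [c [K H]] := qf 1; exists K => x.
pose st r := if is_input r then inp x r else
             if r == W 0 then nseq (N x) true else [::].
have st_W i : st (W i) = if i == 0 then nseq (N x) true else [::].
  by rewrite /st (negPf (W_input i)) W_eq.
have [|s [_ <- sz]] := H x st; last first.
  by apply: leq_trans (nat_of_bits_lt _) _; rewrite leq_exp2l.
split=> // [r in_r|i i_gt0]; first by rewrite /st in_r.
by rewrite st_W gtn_eqF.
Qed.

Lemma quad_ext f g : f =1 g -> quad f -> quad g.
Proof. exact: computes_ext. Qed.

(** The constant [c] is unfolded in the program, as [c] loops in a row. *)
Lemma quad_iterM c k (step : (nat -> nat) -> nat -> nat) (init : nat -> X -> nat) :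
    (forall b0 j, j < k -> computes (D := linear W_inj b0 k) (fun x => step x.2 j)) ->
    (forall j, j < k -> quad (init j)) ->
  forall j, j < k -> quad (fun x => iter (c * N x) step (fun i => init i x) j).
Proof.
move=> lin_step q_init; elim: c => [|c IH] j lt_j; first exact: q_init.
apply: quad_ext (quad_iter lin_step IH lt_j) => x.
by rewrite mulSn iterD.
Qed.

Lemma quad_const k : quad (fun=> k).
Proof. exact: computes_const. Qed.

Lemma quad_add f g : quad f -> quad g -> quad (fun x => f x + g x).
Proof. exact: (computes_add W_inj). Qed.

Lemma quad_sub f g : quad f -> quad g -> quad (fun x => f x - g x).
Proof. exact: (computes_sub W_inj). Qed.

Lemma quad_ltn f g : quad f -> quad g -> quadb (fun x => f x < g x).
Proof. exact: (computes_ltn W_inj). Qed.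

Lemma quad_odd f : quad f -> quadb (fun x => odd (f x)).
Proof. exact: computes_odd. Qed.

Lemma quad_if p f g : quadb p -> quad f -> quad g ->
  quad (fun x => if p x then f x else g x).
Proof. exact: computes_if. Qed.

Lemma quad_and p q : quadb p -> quadb q -> quadb (fun x => p x && q x).
Proof.
move=> qp qq; apply: quad_ext (quad_if qp qq (quad_const 0)) => x.
by case: (p x).
Qed.

Lemma quad_not p : quadb p -> quadb (fun x => ~~ p x).
Proof.
move=> qp; apply: quad_ext (quad_if qp (quad_const 0) (quad_const 1)) => x.
by case: (p x).
Qed.

Lemma quad_or p q : quadb p -> quadb q -> quadb (fun x => p x || q x).
Proof.
move=> qp qq; apply: quad_ext (quad_not (quad_and (quad_not qp) (quad_not qq))) => x.
by case: (p x); case: (q x).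
Qed.

Lemma quad_eq f g : quad f -> quad g -> quadb (fun x => f x == g x).
Proof.
move=> qf qg; apply: quad_ext (quad_ltn (quad_add
  (quad_sub qf qg) (quad_sub qg qf)) (quad_const 1)) => x.
by congr nat_of_bool; lia.
Qed.

Lemma quad_leq f g : quad f -> quad g -> quadb (fun x => f x <= g x).
Proof.
move=> qf qg; apply: quad_ext (quad_not (quad_ltn qg qf)) => x.
by rewrite -leqNgt.
Qed.

Lemma quad_sum I (s : seq I) (P : pred I) (F : I -> X -> nat) :
  (forall i, quad (F i)) -> quad (fun x => \sum_(i <- s | P i) F i x).
Proof.
move=> qF; elim: s => [|i s IH].
  by apply: quad_ext (quad_const 0) => x; rewrite big_nil.
case Pi: (P i); last by apply: quad_ext IH => x; rewrite big_cons Pi.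
by apply: quad_ext (quad_add (qF i) IH) => x; rewrite big_cons Pi.
Qed.

Lemma quad_all I (s : seq I) (F : I -> X -> bool) :
  (forall i, quadb (F i)) -> quadb (fun x => all (F^~ x) s).
Proof.
move=> qF; elim: s => [|i s IH] /=; first exact: (quad_const 1).
exact: quad_and.
Qed.

Lemma quad_forall (I : finType) (F : I -> X -> bool) :
  (forall i, quadb (F i)) -> quadb (fun x => [forall i, F i x]).
Proof.
move=> qF; apply: quad_ext (quad_all (enum I) qF) => x; congr nat_of_bool.
by apply/allP/forallP => H i; [apply: H; rewrite mem_enum|move=> _; apply: H].
Qed.

(** Shift and add, with [e 0 + e 1 * e 2] invariant; the accumulator [e 0] is the product once [e 2]
    has been shifted to 0. *)
Definition mul_step (e : nat -> nat) := nth 0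
  [:: if odd (e 2) then e 0 + e 1 else e 0; (e 1).*2; (e 2)./2].

Lemma mul_stepE t e : let e' := iter t mul_step e in
  e' 0 + e' 1 * e' 2 = e 0 + e 1 * e 2 /\ e' 2 = e 2 %/ 2 ^ t.
Proof.
elim: t => [|t /= [IH1 IH2]] /=; first by rewrite divn1.
set e' := iter t _ _ in IH1 IH2 *; split.
  rewrite -IH1 -[in RHS](odd_double_half (e' 2)).
  rewrite /mul_step /=; move: (e' 0) (e' 1) (_./2) => a b h.
  by case: (odd _); rewrite /= -!muln2; nia.
by rewrite {1}/mul_step /= IH2 -divn2 -divnMA expnS mulnC.
Qed.

Lemma quad_mul f g : quad f -> quad g -> quad (fun x => f x * g x).
Proof.
move=> qf qg; have [c lt_c] := quad_bound qg.
pose init j x := nth 0 [:: 0; f x; g x] j.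
have q_init j : j < 3 -> quad (init j).
  by case: j => [|[|[|j]]] //= _; apply: quad_const.
have lin b0 j : j < 3 -> computes (D := linear W_inj b0 3) (fun x => mul_step x.2 j).
  by case: j => [|[|[|j]]] // _; cbv [mul_step nth]; linear_tac.
apply: quad_ext (quad_iterM c lin q_init (isT : 0 < 3)) => x.
have [e1 e2] := mul_stepE (c * N x) (init^~ x).
by move: e1; rewrite e2 (divn_small (lt_c x)) muln0 addn0.
Qed.

Lemma quad_exp2 c : quad (fun x => 2 ^ (c * N x)).
Proof.
pose step (e : nat -> nat) (j : nat) := (e 0).*2.
have lin b0 j : j < 1 -> computes (D := linear W_inj b0 1) (fun x => step x.2 j).
  by move=> _; rewrite /step; linear_tac.
apply: quad_ext (quad_iterM (init := fun _ _ => 1) c lin _ (isT : 0 < 1)).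
  move=> x; elim: (c * N x) => //= t IH.
  by rewrite {1}/step IH expnS mul2n.
by move=> j _; apply: quad_const.
Qed.

(** Restoring division: the shifted divisor [e 1] is halved before each trial subtraction from the
    remainder [e 0], and [e 2] collects the bits of the quotient. *)
Definition div_step (e : nat -> nat) :=
  let h := (e 1)./2 in
  nth 0 [:: if e 0 < h then e 0 else e 0 - h; h;
            if e 0 < h then (e 2).*2 else (e 2).*2 + 1].

Lemma div_stepE d a b t k : 0 < d -> a < d * 2 ^ (t + k) ->
  b = d * 2 ^ (t + k) ->
  let e' := iter t div_step (nth 0 [:: a; b; 0]) in
  [/\ a = e' 2 * (d * 2 ^ k) + e' 0, e' 1 = d * 2 ^ k & e' 0 < e' 1].
Proof.
move=> d_gt0; elim: t k => [|t IH] k lt_a def_b; first by rewrite /= def_b.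
move: lt_a def_b; rewrite addSnnS => lt_a /(IH _ lt_a) [].
rewrite iterS /=; set e' := iter t _ _ => e1 e2 e3.
have half : (e' 1)./2 = d * 2 ^ k by rewrite e2 expnS mulnCA mul2n doubleK.
cbv [div_step nth]; rewrite half; rewrite e2 in e3; rewrite expnS in e1 e3.
move: (d * 2 ^ k) (mulnCA d 2 (2 ^ k)) e1 e3 => D -> e1 e3.
case: ltnP => [lt|ge] /=; split=> //.
- by rewrite {1}e1 -muln2; nia.
- by rewrite {1}e1 -muln2; nia.
by lia.
Qed.

Lemma quad_divmod f g : quad f -> quad g ->
  quad (fun x => f x %/ g x) /\ quad (fun x => f x %% g x).
Proof.
move=> qf qg; have [c lt_c] := quad_bound qf.
(* After [c * N x] halvings the shifted divisor is [g x] again, and [f x < 2 ^ (c * N x)] starts the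
   invariant when [g x] is positive. A zero divisor is treated apart below, with the conventions of
   [divn0] and [modn0]. *)
pose init j x := nth 0 [:: f x; g x * 2 ^ (c * N x); 0] j.
have q_init j : j < 3 -> quad (init j).
  case: j => [|[|[|j]]] //= _; last exact: computes_const.
  exact: quad_mul (quad_exp2 _).
have lin b0 j : j < 3 -> computes (D := linear W_inj b0 3) (fun x => div_step x.2 j).
  by case: j => [|[|[|j]]] // _; cbv [div_step nth]; linear_tac.
have q_res j := quad_iterM c lin q_init (j := j).
pose res x := iter (c * N x) div_step (init^~ x).
have resE x : 0 < g x -> f x = res x 2 * g x + res x 0 /\ res x 0 < g x.
  move=> g_gt0; have := @div_stepE (g x) (f x) _ (c * N x) 0 g_gt0 _ erefl.
  rewrite addn0 muln1 => /(_ _) [|e1 e2 e3].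
    by apply: leq_trans (lt_c x) _; rewrite leq_pmull.
  by rewrite /res; split=> //; rewrite -[ltnRHS]e2.
split.
  apply: quad_ext (quad_if (quad_ltn (quad_const 0) qg)
    (q_res 2 isT) (quad_const 0)) => x.
  case: posnP => [->|/resE[e1 lt]]; first by rewrite divn0.
  by rewrite [in RHS]e1 divnMDl ?(leq_ltn_trans _ lt) // divn_small // addn0.
apply: quad_ext (quad_if (quad_ltn (quad_const 0) qg)
    (q_res 0 isT) qf) => x.
case: posnP => [->|/resE[e1 lt]]; first by rewrite modn0.
by rewrite [in RHS]e1 modnMDl modn_small.
Qed.

Lemma quad_div f g : quad f -> quad g -> quad (fun x => f x %/ g x).
Proof. by move=> qf qg; have [] := quad_divmod qf qg. Qed.

Lemma quad_mod f g : quad f -> quad g -> quad (fun x => f x %% g x).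
Proof. by move=> qf qg; have [] := quad_divmod qf qg. Qed.


Lemma quad_bezout p q : quad p -> quad q -> exists u G,
  [/\ quad u, quad G & forall x, odd (q x) ->
    G x = gcdn (p x) (q x) /\ u x * p x = gcdn (p x) (q x) %[mod q x]].
Proof.
move=> qp qq; have [c lt_c] := quad_bound (quad_mul qp qq).
pose init j x := nth 0 [:: p x; q x; 1; 0; q x] j.
have q_init j : j < 5 -> quad (init j).
  by case: j => [|[|[|[|[|j]]]]] //= _; apply: quad_const.
have lin b0 j : j < 5 ->
    computes (D := linear W_inj b0 5) (fun x => bezout_step x.2 j).
  by case: j => [|[|[|[|[|j]]]]] // _; cbv [bezout_step half_mod sub_mod nth];
    linear_tac.
have q_res j := quad_iterM c lin q_init (j := j).
exists (fun x => iter (c * N x) bezout_step (init^~ x) 3).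
exists (fun x => iter (c * N x) bezout_step (init^~ x) 1).
split; [exact: q_res|exact: q_res|] => x odd_q.
by have [-> ->] := bezout_stepE odd_q (lt_c x).
Qed.

Lemma quad_strip p q : quad p -> quad q -> exists p' q' d,
  [/\ quad p', quad q', quad d & forall x, 0 < p x ->
    [/\ p x = p' x * d x, q x = q' x * d x & odd (p' x) || odd (q' x)]].
Proof.
move=> qp qq; have [c lt_c] := quad_bound qp.
pose init j x := nth 0 [:: p x; q x; 1] j.
have q_init j : j < 3 -> quad (init j).
  by case: j => [|[|[|j]]] //= _; apply: quad_const.
have lin b0 j : j < 3 ->
    computes (D := linear W_inj b0 3) (fun x => strip_step x.2 j).
  by case: j => [|[|[|j]]] // _; cbv [strip_step nth]; linear_tac.
have q_res j := quad_iterM c lin q_init (j := j).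
exists (fun x => iter (c * N x) strip_step (init^~ x) 0).
exists (fun x => iter (c * N x) strip_step (init^~ x) 1).
exists (fun x => iter (c * N x) strip_step (init^~ x) 2).
split; [exact: q_res|exact: q_res|exact: q_res|] => x p_gt0.
exact: (strip_stepE _ p_gt0 (lt_c x)).
Qed.

(** After stripping, at least one number is odd; both orders of the arguments are prepared, and
    parity selects the one with an odd modulus. *)
Lemma quad_gcd p q : quad p -> quad q -> quad (fun x => gcdn (p x) (q x)).
Proof.
move=> qp qq; have [p' [q' [d [qp' qq' qd strip]]]] := quad_strip qp qq.
have [u1 [G1 [_ qG1 eG1]]] := quad_bezout qp' qq'.
have [u2 [G2 [_ qG2 eG2]]] := quad_bezout qq' qp'.
apply: quad_ext (quad_if (quad_eq qp (quad_const 0)) qq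
  (quad_mul qd (quad_if (quad_odd qq') qG1 qG2))) => x.
have [->|] := posnP (p x); first by rewrite gcd0n.
move=> p_gt0; have [ep eq odd_pq] := strip x p_gt0.
rewrite [in RHS]ep [in RHS]eq -muln_gcdl mulnC; congr (_ * _).
case: ifPn odd_pq => [/eG1[-> //]|]; rewrite orbC /= => _ /eG2[-> _].
exact: gcdnC.
Qed.

Lemma quad_lcm p q : quad p -> quad q -> quad (fun x => lcmn (p x) (q x)).
Proof. by move=> qp qq; exact: (quad_div (quad_mul qp qq) (quad_gcd qp qq)). Qed.

Lemma quad_crt a1 p1 a2 p2 : quad a1 -> quad p1 -> quad a2 -> quad p2 ->
  exists z, quad z /\ forall x, 0 < p1 x -> 0 < p2 x -> forall z0,
    z0 = a1 x %[mod p1 x] -> z0 = a2 x %[mod p2 x] ->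
    z x = z0 %% lcmn (p1 x) (p2 x).
Proof.
move=> qa1 qp1 qa2 qp2.
have [q1 [q2 [d [qq1 qq2 qd strip]]]] := quad_strip qp1 qp2.
have [u1 [G1 [qu1 _ eu1]]] := quad_bezout qq1 qq2.
have [u2 [G2 [qu2 _ eu2]]] := quad_bezout qq2 qq1.
pose F a p b q (u : X -> nat) x :=
  (a x + p x * (u x * ((b x + a x * (q x - 1)) %/ gcdn (p x) (q x))))
    %% lcmn (p x) (q x).
have qF a p b q u : quad a -> quad p -> quad b -> quad q -> quad u ->
    quad (F a p b q u).
  move=> qa qp qb qq qu; apply: (quad_mod _ (quad_lcm qp qq)).
  apply: (quad_add qa); apply: (quad_mul qp); apply: (quad_mul qu).
  apply: (quad_div _ (quad_gcd qp qq)); apply: (quad_add qb).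
  by apply: (quad_mul qa); apply: (quad_sub qq); apply: quad_const.
exists (fun x => if odd (q2 x) then F a1 p1 a2 p2 u1 x else F a2 p2 a1 p1 u2 x).
split; first by apply: (quad_if (quad_odd qq2)); apply: qF.
move=> x p1_gt0 p2_gt0 z0 e1 e2; have [ep1 ep2 odd12] := strip x p1_gt0.
case: ifPn odd12 => [odd2 _|_]; last first.
  rewrite orbF => /eu2[_ eu]; rewrite lcmnC; apply: crt_formula => //.
  (* A Bezout congruence for the stripped pair, multiplied by [d], is one for the original pair with
     the same coefficient. *)
  by rewrite ep1 ep2 mulnA -muln_gcdl -!muln_modl eu.
have [_ eu] := eu1 x odd2; apply: crt_formula => //.
by rewrite ep1 ep2 mulnA -muln_gcdl -!muln_modl eu.
Qed.

(** The moduli are merged one by one, the partial lcm being computed along with the residue; the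
    common solution [z0] guarantees that every intermediate pair is compatible. *)
Lemma quad_crts I (s : seq I) (a p : I -> X -> nat) :
    (forall i, quad (a i)) -> (forall i, quad (p i)) ->
  exists z, quad z /\ forall x, (forall i, 0 < p i x) -> forall z0,
    (forall i, z0 = a i x %[mod p i x]) -> z x = z0 %% \big[lcmn/1]_(i <- s) p i x.
Proof.
move=> qa qp.
suff [z [M [qz _ zE]]] : exists z M, [/\ quad z, quad M & forall x,
    (forall i, 0 < p i x) -> forall z0, (forall i, z0 = a i x %[mod p i x]) ->
    [/\ z x = z0 %% M x, 0 < M x & M x = \big[lcmn/1]_(i <- s) p i x]].
  by exists z; split=> // x p_gt0 z0 /(zE x p_gt0)[-> _ ->].
elim: s => [|i s [z [M [qz qM zE]]]].
  exists (fun=> 0), (fun=> 1); split; try exact: quad_const.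
  by move=> x _ z0 _; rewrite modn1 big_nil.
have [z' [qz' z'E]] := quad_crt (qa i) (qp i) qz qM.
exists z', (fun x => lcmn (p i x) (M x)); split=> //; first exact: quad_lcm.
move=> x p_gt0 z0 ea; have [ez M_gt0 eM] := zE x p_gt0 z0 ea.
rewrite big_cons -eM lcmn_gt0 p_gt0 M_gt0; split=> //.
by apply: z'E; rewrite // ez modn_mod.
Qed.

End Arithmetic.

Arguments quad_const {R W W_inj X inp is_input N N_gt0 W_input} k.

(** * Blocks and codewords *)

Section Window.

Variables (m L : nat).
Hypotheses (m_gt0 : 0 < m) (le_mL : m.*2 <= L).
Implicit Types (y s r : nat).

(* The window [y, y + m) modulo [L] contains every residue modulo [m] exactly once. *)
Definition regular y := (m %| L) || (y + m <= L).

(* The element of residue [r] of a regular window at [y], and its offset. *)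
Definition offset y r := (r + (m - y %% m)) %% m.
Definition pos y r := (y + offset y r) %% L.

Lemma offset_lt y r : offset y r < m.
Proof. exact: ltn_pmod. Qed.

(** Residues below [y %% m] were passed before [y] in its own cell, so the window meets them in the
    next one; this is the origin of the bit in the congruences. *)
Lemma offsetE y r : r < m -> y + offset y r = (y %/ m + (r < y %% m)) * m + r.
Proof.
move=> lt_r; have lt := ltn_pmod y m_gt0; rewrite /offset {1}(divn_eq y m) mulnDl.
move: lt lt_r; move: (y %% m) (y %/ m * m) => t a lt_t lt_r.
case: ltnP => [lt|ge]; first by rewrite modn_small /=; lia.
have -> : r + (m - t) = (r - t) + m by lia.
by rewrite modnDr modn_small /=; lia.
Qed.

Lemma offsetK y s : s < m -> offset y ((y + s) %% m) = s.
Proof.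
move=> lt_s; rewrite /offset modnDml -[X in X + s + _](modnDr y 0) addn0.
rewrite {1}(divn_eq y m) -!addnA modnMDl addnCA addnA.
have lt := ltn_pmod y m_gt0.
have -> : s + y %% m + (m - y %% m) = s + m by lia.
by rewrite modnDr modn_small.
Qed.

Lemma regular_mod y s : regular y -> s < m -> (y + s) %% L %% m = (y + s) %% m.
Proof.
case/orP=> [dv _|le lt]; first by rewrite modn_dvdm.
by rewrite [_ %% L]modn_small //; lia.
Qed.

Lemma pos_mod y r : regular y -> r < m -> pos y r %% m = r.
Proof.
move=> reg lt_r; rewrite /pos regular_mod ?offset_lt // offsetE //.
by rewrite modnMDl modn_small.
Qed.

Lemma posK y s : regular y -> s < m -> pos y ((y + s) %% L %% m) = (y + s) %% L.
Proof. by move=> reg lt_s; rewrite regular_mod // /pos offsetK. Qed.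

Lemma pos_div_small y r : y + m <= L -> r < m ->
  pos y r %/ m = y %/ m + (r < y %% m).
Proof.
move=> le lt_r; have lt := offset_lt y r; rewrite /pos modn_small; last lia.
by rewrite offsetE // divnMDl // (divn_small lt_r) addn0.
Qed.

Lemma pos_div_dvd y r : m %| L -> r < m ->
  pos y r %/ m = (y %/ m + (r < y %% m)) %% (L %/ m).
Proof.
move=> dv lt_r; rewrite /pos offsetE //.
move: (_ + (r < _)) => a; rewrite -[in X in _ %% X](divnK dv).
have a_gt0 : 0 < L %/ m by rewrite divn_gt0 //; lia.
move: (L %/ m) a_gt0 => d d_gt0.
rewrite {1}(divn_eq a d) mulnDl -mulnA -addnA modnMDl modn_small.
  by rewrite divnMDl // (divn_small lt_r) addn0.
have lt := ltn_pmod a d_gt0.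
have : (a %% d).+1 * m <= d * m by rewrite leq_mul2r lt orbT.
by rewrite mulSn; lia.
Qed.

Definition occ y r := \sum_(s < m) ((y + s) %% L %% m == r).

(** Sliding the window by one trades its first point for the one just after its last. *)
Lemma occ_shift y r : (y %% L %% m == r) + occ y.+1 r =
  occ y r + ((y + m) %% L %% m == r).
Proof.
rewrite /occ -(big_mkord xpredT (fun s => nat_of_bool ((y.+1 + s) %% L %% m == r))).
rewrite -(big_mkord xpredT (fun s => nat_of_bool ((y + s) %% L %% m == r))).
rewrite -big_nat_recr //= big_nat_recl //= addn0; congr (_ + _).
by apply: eq_bigr => s _; rewrite addSnnS.
Qed.

Lemma occ_small y r : y + m <= L -> occ y r = occ L r.
Proof.
have -> : occ L r = occ 0 r by apply: eq_bigr => s _; rewrite modnDl.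
elim: y => // y IH le; rewrite -IH; last lia.
apply: (@addnI (y %% L %% m == r)); rewrite occ_shift addnC; congr (nat_of_bool _ + _).
by rewrite ![_ %% L]modn_small ?modnDr //; lia.
Qed.

(** Compared with the window at [L], which is [0, m) modulo [L], the wrapped one loses the residues
    [m - t], ..., [m - 1] and gains those of the last [t] points before [L]. *)
Lemma occ_wrap t r : t < m ->
  occ (L - t) r + \sum_(1 <= s < t.+1) (m - s == r) =
  occ L r + \sum_(1 <= s < t.+1) ((L - s) %% m == r).
Proof.
elim: t => [|t IH] lt_t; first by rewrite !big_geq // subn0.
rewrite (big_nat_recr t.+1) //= (big_nat_recr t.+1) //= addnA [in RHS]addnA -IH 1?ltnW //.
have := occ_shift (L - t.+1) r.
have -> : (L - t.+1).+1 = L - t by lia.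
have -> : (L - t.+1 + m) %% L %% m = m - t.+1.
  have -> : L - t.+1 + m = m - t.+1 + L by lia.
  by rewrite modnDr !modn_small //; lia.
rewrite [(L - t.+1) %% L]modn_small; last lia.
by lia.
Qed.

(** Equal counts make the interval [m - t', m - t) stable under adding [b = L %% m] modulo [m].
    Stability at its two ends forces it to contain [m - b], whose translate 0 lies below the
    interval. *)
Lemma occ_wrap_inj t t' : ~~ (m %| L) -> t < t' < m ->
  (forall r, r < m -> occ (L - t) r = occ (L - t') r) -> False.
Proof.
move=> ndv /andP[lt_t lt_t'] eq_occ.
have [b def_b] : {b | L %% m = b} by exists (L %% m).
have b_gt0 : 0 < b by rewrite -def_b lt0n.
have b_lt : b < m by rewrite -def_b ltn_pmod.
have closed i : m - t' <= i < m - t ->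
    m - t' <= (if i + b < m then i + b else i + b - m) < m - t.
  move=> i_in; set r := if _ then _ else _.
  have lt_r : r < m by rewrite /r; case: (ltnP (i + b)); lia.
  have r_mod : (L - (m - i)) %% m = r.
    have -> : L - (m - i) = (L %/ m - 1) * m + (i + b).
      rewrite mulnBl mul1n {1}(divn_eq L m) def_b.
      have : m <= L %/ m * m by rewrite leq_pmull // divn_gt0 //; lia.
      by lia.
    rewrite modnMDl /r; case: (ltnP (i + b)) => [lt|ge]; first exact: modn_small.
    by rewrite -{1}(subnK ge) modnDr modn_small //; lia.
  (* The two identities differ by the terms with [t < s <= t']. On the right the term [s = m - i]
     equals 1, so some term on the left is nonzero, which puts [r] in the interval. *)
  have := occ_wrap r lt_t'; have := occ_wrap r (ltn_trans lt_t lt_t').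
  rewrite (eq_occ r lt_r) => e1 e2.
  have {e1 e2} : \sum_(t.+1 <= s < t'.+1) (m - s == r) =
      \sum_(t.+1 <= s < t'.+1) ((L - s) %% m == r).
    move: e2; rewrite !(@big_cat_nat _ _ _ t.+1 1 t'.+1) //=; lia.
  rewrite [RHS](bigD1_seq (m - i)) ?iota_uniq ?mem_index_iota //=; last lia.
  rewrite r_mod eqxx; have [in_r|out_r] := boolP (m - t' <= r < m - t) => //.
  rewrite big_nat_cond big1 // => s /andP[/andP[s1 s2] _].
  by case: eqP => // e; case/negP: out_r; lia.
have := closed (m - t') _; have := closed (m - t).-1 _; have := closed (m - b) _.
by case: (ltnP (m - t' + b)); case: (ltnP ((m - t).-1 + b)); case: (ltnP (m - b + b)); lia.
Qed.

Lemma occ_inj y y' : ~~ (m %| L) -> y < L -> y' < L ->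
  ~~ regular y || ~~ regular y' ->
  (forall r, r < m -> occ y r = occ y' r) -> y = y'.
Proof.
rewrite /regular => /[dup] ndv /negPf -> /=; rewrite -!ltnNge => lt lt' irr eq_occ.
(* All windows that do not wrap have the counts of the window at [L] and share the parameter 0. *)
pose t z := if L < z + m then L - z else 0.
have occ_t z r : z < L -> occ (L - t z) r = occ z r.
  rewrite /t; case: (ltnP L) => [? ?|le _]; last by rewrite subn0 occ_small.
  by rewrite subKn // ltnW.
have t_lt z : t z < m by rewrite /t; case: (ltnP L); lia.
have eq_t r : r < m -> occ (L - t y) r = occ (L - t y') r.
  by move=> lt_r; rewrite !occ_t // eq_occ.
have [lt_t|lt_t|] := ltngtP (t y) (t y').
- by case: (@occ_wrap_inj (t y) (t y')); rewrite ?lt_t ?t_lt.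
- by case: (@occ_wrap_inj (t y') (t y)); rewrite ?lt_t ?t_lt // => r /eq_t.
by rewrite /t; case/orP: irr => ->; case: (ltnP L); lia.
Qed.

End Window.

Lemma perm_map_in (T1 T2 : eqType) (f : T1 -> T2) (s1 s2 : seq T1) :
  {in s1 ++ s2 &, injective f} -> perm_eq (map f s1) (map f s2) -> perm_eq s1 s2.
Proof.
move=> f_inj; case def_s: (s1 ++ s2) => [|a s].
  by move/(congr1 size): def_s; rewrite size_cat; case: s1 {f_inj} => //; case: s2.
pose h v := nth a (s1 ++ s2) (index v (map f (s1 ++ s2))).
have hK : {in s1 ++ s2, cancel f h}.
  move=> z z_in; rewrite /h; have lt : index (f z) (map f (s1 ++ s2)) < size (s1 ++ s2).
    by rewrite -(size_map f) index_mem map_f.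
  apply: f_inj => //; first exact: mem_nth.
  by rewrite -(nth_map _ (f z)) // nth_index // map_f.
move/(perm_map h); rewrite -!map_comp.
rewrite !map_id_in // => z z_in; apply: hK; rewrite mem_cat z_in ?orbT //.
Qed.

(** * Codewords as lists of integers, and consistent candidates *)

Section Decoding.

Variables (n : nat) (m : 'I_n -> nat) (m_gt0 : forall i, 0 < m i) (g : nat).
Variable U : ub_data m g.
Hypotheses (n_gt0 : 0 < n) (g_ge2 : 1 < g) (code : unitary_braid_code U).

Local Notation L := (ub_side U).
Local Notation q := (ub_q U).
Local Notation symbol := (symbol m).

Lemma side_gt0 i : 0 < L i.
Proof. by have := ub_side_ge code i; have := m_gt0 i; lia. Qed.

Lemma double_side i : (m i).*2 <= L i.
Proof. by rewrite -mul2n (ub_side_ge code). Qed.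

Lemma len_gt0 i J : 0 < ub_len U i J.
Proof. by rewrite muln_gt0 (ltnW g_ge2) (ub_q_gt0 code). Qed.

(** These are the indices whose factor in direction [i] may be replaced; they also serve to probe
    one residue of that direction at a time. *)
Definition axis i r : grid m :=
  [ffun k => insubd (Ordinal (m_gt0 k)) (if k == i then r else 0)].

Lemma axisE i r k : r < m i -> axis i r k = (if k == i then r else 0) :> nat.
Proof.
move=> lt_r; rewrite ffunE val_insubd; case: eqP => [->|_]; first by rewrite lt_r.
by rewrite m_gt0.
Qed.

(** The integer representing the factor [ub_coord U i J l]; the out-of-range value [ub_len U i J]
    marks a new factor, as in [symbol_valid]. *)
Definition ub_val i (J : grid m) l :=
  if ub_replaced U i J && (l == L i %/ m i - 1) then ub_len U i J
  else l %% ub_len U i J.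

Lemma ub_coord_val i J l : ub_coord U i J l =
  if ub_val i J l < ub_len U i J then ub_Gamma U i J (ub_val i J l) else ub_new U i J.
Proof.
rewrite /ub_coord /ub_val; case: ifP => _; first by rewrite ltnn.
by rewrite ltn_pmod ?len_gt0.
Qed.

Definition point_symbol (z : grid L) : symbol :=
  (residue m_gt0 z, [ffun i => ub_val i (residue m_gt0 z) (z i %/ m i)]).

Lemma symbol_valid_point z : symbol_valid U (point_symbol z).
Proof.
apply/forallP => i; rewrite ffunE /= /ub_val; case: ifP => [/andP[-> _]|_].
  by rewrite eqxx orbT.
by rewrite ltn_pmod ?len_gt0.
Qed.

Lemma symbol_color_point z : symbol_color U (point_symbol z) = ub_color m_gt0 z.
Proof. by apply/ffunP => i; rewrite [LHS]ffunE /= !ffunE ub_coord_val. Qed.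

Lemma Gamma_factors i J s : s < ub_len U i J -> ub_Gamma U i J s \in ub_factors U i J.
Proof. by move=> lt; apply: map_f; rewrite mem_iota. Qed.

Lemma Gamma_inj i J s t : s < ub_len U i J -> t < ub_len U i J ->
  ub_Gamma U i J s = ub_Gamma U i J t -> s = t.
Proof.
move=> lt_s lt_t e; have uq := ub_Gamma_bij code i J.
have nthE a : a < ub_len U i J -> nth (ub_new U i J) (ub_factors U i J) a = ub_Gamma U i J a.
  by move=> lt; rewrite (nth_map 0) ?size_iota // nth_iota.
apply/eqP; rewrite -(nth_uniq (ub_new U i J) _ _ uq) ?size_map ?size_iota //.
by rewrite !nthE // e.
Qed.

Lemma Gamma_index i J J' s s' : s < ub_len U i J -> s' < ub_len U i J' ->
  ub_Gamma U i J s = ub_Gamma U i J' s' -> J = J'.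
Proof.
move=> lt lt' e; apply/eqP; apply/idPn => ne.
have neq : (i, J) != (i, J') by rewrite xpair_eqE eqxx.
have /hasP[] := ub_factors_disjoint code neq.
by exists (ub_Gamma U i J' s'); rewrite /= -?e; rewrite ?Gamma_factors // e Gamma_factors.
Qed.

Lemma Gamma_new i J J' s : s < ub_len U i J -> ub_replaced U i J' ->
  ub_Gamma U i J s <> ub_new U i J'.
Proof.
move=> lt rep e; have /negP[] := ub_new_fresh code i J rep.
by rewrite -e Gamma_factors.
Qed.

(** One factor already reveals the index, by disjointness of the factor sets and freshness of the
    new factors; [0 < n] supplies a coordinate to look at. *)
Lemma symbol_color_inj c c' : symbol_valid U c -> symbol_valid U c' ->
  symbol_color U c = symbol_color U c' -> c = c'.
Proof.
case: c c' => [J s] [J' s'] /forallP val /forallP val' /ffunP e.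
have eJ : J = J'.
  have := e (Ordinal n_gt0); have := val (Ordinal n_gt0); have := val' (Ordinal n_gt0).
  rewrite !ffunE /=; move: (Ordinal n_gt0) => i.
  case: ifPn => lt; case: ifPn => lt' /= H' H.
  - exact: Gamma_index.
  - by case/andP: H' => _ rep e1; case: (Gamma_new lt rep e1).
  - by case/andP: H => _ rep e1; case: (Gamma_new lt' rep (esym e1)).
  case/andP: H H' => _ rep /andP[_ rep']; exact: ub_new_inj.
rewrite -{J'}eJ in val' e *; congr (_, _); apply/ffunP => i.
have := e i; have := val i; have := val' i; rewrite !ffunE /=.
case: ifPn => lt; case: ifPn => lt' /= H' H.
- exact: Gamma_inj.
- by case/andP: H' => _ rep e1; case: (Gamma_new lt rep e1).
- by case/andP: H => _ rep e1; case: (Gamma_new lt' rep (esym e1)).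
by case/andP: H H' => /eqP-> _ /andP[/eqP->].
Qed.

Definition point (x : grid L) (J : grid m) : grid L :=
  [ffun k => Ordinal (ltn_pmod (x k + J k) (side_gt0 k))].

Lemma pointE x J k : point x J k = (x k + J k) %% L k :> nat.
Proof. by rewrite ffunE. Qed.

Lemma point_inj x : injective (point x).
Proof.
move=> J J' e; apply/ffunP => k; apply: val_inj => /=.
have := congr1 (fun z : grid L => z k : nat) e; rewrite /= !pointE => /eqP.
rewrite eqn_modDl => /eqP.
have lt (T : grid m) : T k < L k.
  by have := ltn_ord (T k); have := double_side k; lia.
by rewrite !modn_small.
Qed.

Lemma perm_block x : perm_eq (enum (block x)) [seq point x J | J <- enum {: grid m}].
Proof.
apply: uniq_perm; rewrite ?enum_uniq //.
  by rewrite map_inj_uniq ?enum_uniq //; apply: point_inj.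
move=> z; rewrite mem_enum inE; apply/existsP/mapP => [[J /forallP e]|[J _ ->]].
  exists J; rewrite ?mem_enum //; apply/ffunP => k; apply: val_inj.
  by rewrite /= pointE; apply/eqP.
by exists J; apply/forallP => k; rewrite pointE.
Qed.

Lemma perm_codeword x :
  perm_eq (codeword m_gt0 x) [seq ub_color m_gt0 (point x J) | J <- enum {: grid m}].
Proof. by have := perm_map (@ub_color n m m_gt0 g U) (perm_block x); rewrite -map_comp. Qed.

Lemma residueE (z : grid L) k : residue m_gt0 z k = z k %% m k :> nat.
Proof. by rewrite ffunE. Qed.

(* Uniqueness from the congruences: [g >= 2] recovers [r], the moduli give [j]. *)
Lemma congruences_inj i j j' r r' : j < g * ub_Q U i -> j' < g * ub_Q U i ->
    r < m i -> r' < m i ->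
    (forall J : grid m, j + (J i < r) = j' + (J i < r') %[mod ub_len U i J]) ->
  j = j' /\ r = r'.
Proof.
move=> lt_j lt_j' lt_r lt_r' cong.
have mod_g p : p < m i -> j + (p < r) = j' + (p < r') %[mod g].
  move=> lt; have := cong (axis i p); rewrite axisE // eqxx => e.
  by rewrite -(modn_dvdm _ (dvdn_mulr (q i (axis i p)) (dvdnn g))) e modn_dvdm ?dvdn_mulr.
have mod_j : j = j' %[mod g].
  (* The last residue is below no remainder, so it shows [j] modulo [g] without the extra bit. *)
  have := mod_g (m i).-1; rewrite prednK ?m_gt0 // => /(_ (leqnn _)).
  have -> : (m i <= r) = false by lia.
  have -> : (m i <= r') = false by lia.
  by rewrite !addn0.
have same p : p < m i -> (p < r) = (p < r').
  move=> lt; have /eqP := mod_g p lt; rewrite -modnDml mod_j modnDml eqn_modDl.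
  by rewrite !modn_small; try (case: (p < r); case: (p < r'); lia).
have er : r = r'.
  by have [lt|lt|//] := ltngtP r r'; [have := same r lt_r|have := same r' lt_r'];
    rewrite lt ltnn.
split=> //; rewrite -er in cong.
have modJ J : j = j' %[mod ub_len U i J].
  by apply/eqP; rewrite -(eqn_modDr (J i < r)); apply/eqP/cong.
have sub a b : b <= a -> a < g * ub_Q U i ->
    (forall J, a = b %[mod ub_len U i J]) -> a = b.
  move=> le lt eq_ab.
  have dvd J : ub_len U i J %| a - b by rewrite -eqn_mod_dvd //; apply/eqP.
  have /dvdnP[d def_d] : g %| a - b.
    exact: dvdn_trans (dvdn_mulr _ (dvdnn g)) (dvd (axis i 0)).
  have dvdQ : ub_Q U i %| d.
    apply/dvdn_biglcmP => J _; have := dvd J; rewrite def_d /ub_len [d * g]mulnC dvdn_pmul2l //.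
    exact: ltnW.
  have : g * ub_Q U i %| a - b by rewrite def_d mulnC dvdn_mul.
  have [z|pos] := posnP (a - b); first by move=> _; clear -z le; lia.
  by move/(dvdn_leq pos); clear -lt; lia.
by have [le|le] := leqP j j'; [apply/esym/sub|apply/sub] => //; apply: ltnW.
Qed.

Lemma side_div_leq i y : y < L i -> y %/ m i < g * ub_Q U i.
Proof.
move=> lt; rewrite ltn_divLR //; apply: leq_trans lt _.
by have := ub_side_le code i; rewrite /ub_std_side mulnAC.
Qed.

Lemma replaced_axis i r : r < m i -> L i != ub_std_side U i -> m i %| L i ->
  ub_replaced U i (axis i r).
Proof.
move=> lt ne dv; rewrite /ub_replaced ne dv; apply/forallP => k.
by apply/implyP => /negPf nk; rewrite axisE // nk.
Qed.

(** If [m i] does not divide [L i], regularity excludes wrapping; for the standard side, reduction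
    modulo the number of cells is invisible modulo each length. For a shortened side divisible by
    [m i], either the block meets the last cell and the new factors locate it, or it stays before
    that cell and the plain congruences hold. *)
Lemma ub_val_inj i y y' : y < L i -> y' < L i ->
    regular (m i) (L i) y -> regular (m i) (L i) y' ->
    (forall J : grid m, ub_val i J (pos (m i) (L i) y (J i) %/ m i) =
                        ub_val i J (pos (m i) (L i) y' (J i) %/ m i)) ->
  y = y'.
Proof.
move=> lt lt' reg reg' eq_val.
have mi := m_gt0 i; have le2 := double_side i.
have [lt_r lt_r'] := (ltn_pmod y mi, ltn_pmod y' mi).
have [lt_j lt_j'] := (side_div_leq lt, side_div_leq lt').
suff [ej er] : y %/ m i = y' %/ m i /\ y %% m i = y' %% m i.
  by rewrite (divn_eq y (m i)) ej er -divn_eq.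
have [dv|ndv] := boolP (m i %| L i); last first.
  have no J : ub_replaced U i J = false by rewrite /ub_replaced (negPf ndv) andbF.
  move: reg reg'; rewrite /regular (negPf ndv) /= => reg reg'.
  apply: (@congruences_inj i) => // J; have := eq_val J.
  by rewrite /ub_val no /= !pos_div_small.
have pd z (J : grid m) : pos (m i) (L i) z (J i) %/ m i =
    (z %/ m i + (J i < z %% m i)) %% (L i %/ m i) by apply: pos_div_dvd.
have [std|nstd] := eqVneq (L i) (ub_std_side U i).
  have no J : ub_replaced U i J = false by rewrite /ub_replaced std eqxx.
  have div_side : L i %/ m i = g * ub_Q U i.
    by rewrite std /ub_std_side mulnAC mulnK.
  apply: (@congruences_inj i) => // J; have := eq_val J.
  have dvJ : ub_len U i J %| g * ub_Q U i by rewrite dvdn_mul // (biglcmn_sup J).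
  by rewrite /ub_val no /= !pd div_side !modn_dvdm.
have div_ge2 : 1 < L i %/ m i by rewrite leq_divRL // mul2n.
have lt_a z : z < L i -> z %/ m i < L i %/ m i by move=> ?; rewrite ltn_divLR // divnK.
set a := L i %/ m i in pd div_ge2 lt_a.
have [lt_ja lt_ja'] := (lt_a _ lt, lt_a _ lt').
pose k j r p := if j + (p < r) == a then 0 else j + (p < r).
have kE j r p : j < a -> (j + (p < r)) %% a = k j r p.
  move=> ltj; rewrite /k; case: eqP => [->|ne]; first by rewrite modnn.
  by rewrite modn_small //; case: (p < r) ne; lia.
(* On the axis a new factor marks exactly the cell [a - 1]: its value [ub_len] is not a residue
   modulo [ub_len]. *)
have at_end p : p < m i -> (k (y %/ m i) (y %% m i) p == a - 1) =
    (k (y' %/ m i) (y' %% m i) p == a - 1).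
  move=> lt_p; have := eq_val (axis i p); rewrite !pd axisE // eqxx !kE //.
  have len := len_gt0 i (axis i p).
  rewrite /ub_val replaced_axis // -/a /=; case: (k _ _ p == _); case: (k _ _ p == _) => // e.
    by have := ltn_pmod (k (y' %/ m i) (y' %% m i) p) len; rewrite -e ltnn.
  by have := ltn_pmod (k (y %/ m i) (y %% m i) p) len; rewrite e ltnn.
move: (y %/ m i) (y %% m i) (y' %/ m i) (y' %% m i) lt_r lt_r' lt_j lt_j' (pd y) (pd y')
  lt_ja lt_ja' at_end kE eq_val => j r j' r' lt_r lt_r' lt_j lt_j' pdy pdy' lt_ja lt_ja'
  at_end _ eq_val.
have [//|[end1 end2]] : (j = j' /\ r = r') \/
    (j + (0 < r) < a - 1 /\ j' + (0 < r') < a - 1).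
  have eq_r : (forall p, p < m i -> (p < r) = (p < r')) -> r = r'.
    by move=> H; have [lt1|lt1|//] := ltngtP r r';
      [have := H r lt_r|have := H r' lt_r']; rewrite lt1 ltnn.
  (* A residue below [b] wraps from cell [a - 1] to cell 0, a different one as [a] is at least 2. *)
  have k_last b p : (k (a - 1) b p == a - 1) = ~~ (p < b).
    rewrite /k; case: (p < b) => /=; last by rewrite addn0 ifN ?eqxx //; clear -div_ge2; lia.
    have -> : a - 1 + 1 = a by clear -div_ge2; lia.
    by rewrite eqxx; clear -div_ge2; lia.
  have k_small b c p : b < a - 1 -> k b c p = b + (p < c).
    by move=> ltb; rewrite /k ifN //; case: (p < c); lia.
  (* The residue [m i - 1] always lies in the cell of the starting point. *)
  have last : (j == a - 1) = (j' == a - 1).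
    have := at_end (m i).-1; rewrite prednK // => /(_ (leqnn _)).
    have kl b c : b < a -> c < m i -> k b c (m i).-1 = b.
      move=> ltb ltc; rewrite /k.
      have -> : ((m i).-1 < c) = false by clear -ltc; lia.
      by rewrite addn0 ltn_eqF.
    by rewrite !kl.
  have [ej|nj] := eqVneq j (a - 1).
    move: last; rewrite ej eqxx => /esym/eqP ej'; left; split=> //.
    apply: eq_r => p lt_p; have := at_end p lt_p; rewrite ej ej' !k_last.
    exact: negb_inj.
  have {nj} [nj nj'] : j < a - 1 /\ j' < a - 1.
    by move: last; rewrite (negPf nj) => /esym/negbT nj'; lia.
  have k1 p : p < m i -> (j + (p < r) == a - 1) = (j' + (p < r') == a - 1).
    by move=> lt_p; rewrite -!k_small // at_end.
  (* Residue 0 moves to the next cell as soon as any residue does; with [j < a - 1] it meets the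
     last cell only if [j = a - 2]. *)
  have e0 := k1 0 mi; have [j2|nj2] := boolP (j + (0 < r) == a - 1).
    move: e0; rewrite j2 => /esym j2'; left.
    have [ej ej'] : j = a - 2 /\ j' = a - 2.
      by move: nj nj' j2 j2'; clear -div_ge2; case: (0 < r); case: (0 < r'); lia.
    split; first by rewrite ej ej'.
    apply: eq_r => p lt_p; have := k1 p lt_p; rewrite ej ej'; clear -div_ge2.
    by case: (p < r); case: (p < r'); lia.
  move: e0; rewrite (negPf nj2) => /esym/negbT nj2'; right.
  by move: nj nj' nj2 nj2'; clear -div_ge2; case: (0 < r); case: (0 < r'); lia.
apply: (@congruences_inj i) => // J; have := eq_val J; rewrite pdy pdy' /ub_val -/a.
have small b p : b + (0 < p) < a - 1 -> b + (J i < p) < a - 1.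
  by case: (J i) => /= u _; lia.
have [s1 s2] := (small _ _ end1, small _ _ end2).
have [t1 t2] : j + (J i < r) < a /\ j' + (J i < r') < a.
  by split; [move: s1|move: s2]; clear; lia.
by rewrite (modn_small t1) (modn_small t2) (ltn_eqF s1) (ltn_eqF s2) !andbF.
Qed.

(** The factor [p] is the number of indices with a prescribed component in direction [i], whatever
    its value; counts over a block thus reduce to counts over a window. *)
Lemma grid_sum i : exists2 p, 0 < p &
  forall f : nat -> nat, \sum_(J : grid m) f (J i) = p * \sum_(s < m i) f s.
Proof.
pose fiber s (k : 'I_n) := [pred t : 'I_(m k) | (k == i) ==> (t == s :> nat)].
have card_fiber s : s < m i ->
    #|[pred J : grid m | J i == s :> nat]| =
    foldr muln 1 [seq #|fiber 0 k| | k : 'I_n].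
  move=> lt_s; transitivity #|(family (fiber s) : simpl_pred (grid m))|.
    apply: eq_card => J; rewrite !inE; apply/eqP/forallP => [e k|/(_ i)].
      by rewrite inE; apply/implyP => /eqP->; rewrite e.
    by rewrite inE eqxx /= => /eqP.
  rewrite card_family; congr foldr; apply: eq_map => k.
  case: (eqVneq k i) => [->|ne].
    have one t : t < m i -> #|fiber t i| = 1.
      move=> lt; rewrite -(card1 (Ordinal lt)); apply: eq_card => u.
      by rewrite !inE eqxx /= -val_eqE.
    by rewrite !one.
  by apply: eq_card => u; rewrite !inE (negPf ne).
exists (foldr muln 1 [seq #|fiber 0 k| | k : 'I_n]).
  rewrite -(card_fiber 0) //; apply/card_gt0P; exists (axis i 0).
  by rewrite inE axisE // if_same.
move=> f; rewrite (partition_big (fun J : grid m => J i) xpredT) //= big_distrr /=.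
apply: eq_bigr => s _; rewrite -(card_fiber s) // -sum1_card big_distrl /=.
apply: eq_big => J; first by rewrite inE -val_eqE.
by move=> /eqP->; rewrite mul1n.
Qed.

(** Injectivity on valid symbols lifts the permutation from colors to symbols; decoding can then be
    argued on integers. *)
Lemma symbols_perm x (w : (\prod_(i < n) m i).-tuple symbol) :
  represents_codeword m_gt0 w x ->
  perm_eq w [seq point_symbol (point x J) | J <- enum {: grid m}].
Proof.
move=> [/allP valid eq_w]; apply: (@perm_map_in _ _ (symbol_color U)).
  have val c : c \in w ++ [seq point_symbol (point x J) | J <- enum {: grid m}] ->
      symbol_valid U c.
    by rewrite mem_cat => /orP[/valid//|/mapP[J _ ->]]; apply: symbol_valid_point.
  by move=> c c' /val vc /val vc'; apply: symbol_color_inj.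
apply: perm_trans eq_w _; apply: perm_trans (perm_codeword x) _.
rewrite -[map (symbol_color U) _]map_comp.
rewrite (eq_map (g := fun J => ub_color m_gt0 (point x J))) // => J /=.
exact: symbol_color_point.
Qed.

Section Accept.

Variables (i : 'I_n) (w : (\prod_(i < n) m i).-tuple symbol) (y : nat).

Definition consistent := [&& y < L i,
  [forall r : 'I_(m i), \sum_(c < \prod_(i < n) m i) ((tnth w c).1 i == r :> nat) ==
    \sum_(J : grid m) ((y + J i) %% L i %% m i == r)]
  & ~~ regular (m i) (L i) y || [forall c : 'I_(\prod_(i < n) m i),
    (tnth w c).2 i == ub_val i (tnth w c).1 (pos (m i) (L i) y ((tnth w c).1 i) %/ m i)]].

End Accept.

Section Codeword.

Variables (x : grid L) (w : (\prod_(i < n) m i).-tuple symbol).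
Hypothesis rep : represents_codeword m_gt0 w x.

Lemma tnth_point c : exists J, tnth w c = point_symbol (point x J).
Proof.
have := mem_tnth c w; rewrite (perm_mem (symbols_perm rep)) => /mapP[J _ ->].
by exists J.
Qed.

Lemma point_tnth J : exists c, tnth w c = point_symbol (point x J).
Proof.
have : point_symbol (point x J) \in w.
  rewrite (perm_mem (symbols_perm rep)); apply/mapP.
  by exists J; rewrite ?mem_enum.
by move/tnthP=> [c ->]; exists c.
Qed.

Lemma residue_point (J : grid m) k :
  residue m_gt0 (point x J) k = (x k + J k) %% L k %% m k :> nat.
Proof. by rewrite residueE pointE. Qed.

Lemma count_residues i r : \sum_(c < \prod_(i < n) m i) ((tnth w c).1 i == r :> nat) =
  \sum_(J : grid m) ((x i + J i) %% L i %% m i == r).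
Proof.
rewrite -(big_tuple _ _ w xpredT (fun c : symbol => nat_of_bool (c.1 i == r :> nat))).
rewrite (perm_big _ (symbols_perm rep)) big_map big_enum.
by apply: eq_bigr => J _; rewrite residue_point.
Qed.

Lemma consistent_self i : consistent i w (x i).
Proof.
rewrite /consistent ltn_ord /=; apply/andP; split.
  by apply/forallP => r; rewrite count_residues.
have [reg|//] := boolP (regular _ _ _); apply/forallP => c.
have [J ->] := tnth_point c; rewrite /= ffunE residue_point posK ?m_gt0 ?double_side //.
by rewrite pointE.
Qed.

(** Cancelling the common factor of [grid_sum] turns equal counts over the block into equal window
    counts, which [occ_inj] resolves. *)
Lemma consistent_irregular i y : consistent i w y ->
  ~~ regular (m i) (L i) y || ~~ regular (m i) (L i) (x i) -> y = x i.
Proof.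
move=> /and3P[lt /forallP cnt _] irr.
have ndv : ~~ (m i %| L i).
  by move: irr; rewrite /regular; case: (_ %| _).
apply: (occ_inj (m_gt0 i) (double_side i) ndv) => // r lt_r.
have [p p_gt0 sumE] := grid_sum i.
have := eqP (cnt (Ordinal lt_r)); rewrite count_residues /=.
rewrite (sumE (fun s => (x i + s) %% L i %% m i == r)).
rewrite (sumE (fun s => (y + s) %% L i %% m i == r)) => /eqP.
by rewrite eqn_pmul2l // eq_sym => /eqP.
Qed.

Lemma consistent_symbol i y c : consistent i w y -> regular (m i) (L i) y ->
  (tnth w c).2 i = ub_val i (tnth w c).1 (pos (m i) (L i) y ((tnth w c).1 i) %/ m i).
Proof. by move=> /and3P[_ _] + reg; rewrite reg => /forallP/(_ c)/eqP. Qed.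

Lemma residue_onto (J : grid m) : (forall k, regular (m k) (L k) (x k)) ->
  exists c, (tnth w c).1 = J.
Proof.
move=> reg; pose J' : grid m :=
  [ffun k => Ordinal (offset_lt (m_gt0 k) (x k) (J k))].
have [c ec] := point_tnth J'; exists c; rewrite ec; apply/ffunP => k; apply: val_inj.
by rewrite /= residue_point ffunE /= -/(pos _ _ _ _) pos_mod ?double_side ?ltn_ord.
Qed.

Lemma consistent_inj i y : n = 1 \/ (forall k, m k %| L k) ->
  consistent i w y -> y = x i.
Proof.
move=> case_n con.
have [irr|] := boolP (~~ regular (m i) (L i) y || ~~ regular (m i) (L i) (x i)).
  exact: consistent_irregular.
rewrite negb_or !negbK => /andP[reg reg_x].
(* For [n = 1] the only direction is [i], regular in the present case; otherwise divisibility gives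
   regularity in each direction. *)
have regs k : regular (m k) (L k) (x k).
  case: case_n => [n1|dv]; last by rewrite /regular dv.
  have -> // : k = i; apply: val_inj => /=.
  by have := ltn_ord k; have := ltn_ord i; clear -n1; lia.
have /and3P[lt _ _] := con.
apply: (@ub_val_inj i) => // J; have [c <-] := residue_onto J regs.
by rewrite -!consistent_symbol ?consistent_self.
Qed.

(** The map [sh] matches offsets: in a regular direction it picks the point of the window at [y k]
    with the same residue, in an irregular one [y k = x k] and the offset is kept. Matched points
    have equal colors, and an injective map on a finite set permutes it. *)
Lemma consistent_codeword (y : grid L) : (forall i, consistent i w (y i)) ->
  perm_eq (codeword m_gt0 y) (codeword m_gt0 x).
Proof.
move=> con; pose reg k := regular (m k) (L k) (x k).
have reg_y k : reg k -> regular (m k) (L k) (y k).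
  move=> reg_k; apply/idPn => irr.
  by move: (irr); rewrite (consistent_irregular (con k)) ?irr // -/(reg k) reg_k.
have irr_y k : ~~ reg k -> y k = x k.
  by move=> irr; apply: val_inj; apply: consistent_irregular; rewrite ?irr ?orbT.
have lt_sh (J : grid m) k :
    (if reg k then offset (m k) (y k) ((x k + J k) %% L k %% m k) else J k) < m k.
  by case: (reg k); [apply: offset_lt|apply: ltn_ord].
pose sh (J : grid m) : grid m := [ffun k => Ordinal (lt_sh J k)].
have shE J k : point y (sh J) k =
    (if reg k then pos (m k) (L k) (y k) ((x k + J k) %% L k %% m k)
     else point x J k) :> nat.
  rewrite !pointE ffunE /=; case: ifPn => // irr; by rewrite irr_y.
have mod_lt a k : a %% m k < m k by apply: ltn_pmod.
have res J : residue m_gt0 (point y (sh J)) = residue m_gt0 (point x J).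
  apply/ffunP => k; apply: val_inj; rewrite /= !residueE shE pointE.
  by case: ifP => // /reg_y reg_k; rewrite pos_mod ?double_side.
have sh_inj : injective sh.
  move=> J J' e; apply: (@point_inj x); apply/ffunP => k; apply: val_inj => /=.
  have := congr1 (fun z => residue m_gt0 (point y z) k : nat) e.
  rewrite /= !res !residueE => er.
  have := congr1 (fun z : grid m => z k : nat) e; rewrite /= !ffunE /=.
  case: ifP => [reg_k _|_ ej]; last by rewrite ej.
  rewrite !pointE in er.
  rewrite -(posK (m_gt0 k) (double_side k) reg_k (ltn_ord (J k))).
  by rewrite -(posK (m_gt0 k) (double_side k) reg_k (ltn_ord (J' k))) er.
have color J : ub_color m_gt0 (point y (sh J)) = ub_color m_gt0 (point x J).
  apply/ffunP => i; rewrite [LHS]ffunE [RHS]ffunE res shE.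
  case: ifPn => // reg_i; rewrite !ub_coord_val.
  have [c ec] := point_tnth J.
  have := consistent_symbol c (con i) (reg_y i reg_i); rewrite ec /= ffunE.
  by rewrite residue_point => <-.
apply: perm_trans (perm_codeword y) _; rewrite perm_sym.
apply: perm_trans (perm_codeword x) _.
have -> : [seq ub_color m_gt0 (point x J) | J <- enum {: grid m}] =
    [seq ub_color m_gt0 (point y J) | J <- [seq sh J | J <- enum {: grid m}]].
  by rewrite -map_comp; apply: eq_map => J /=; rewrite color.
have uq : uniq (enum {: grid m}) by apply: enum_uniq.
apply: perm_map; rewrite perm_sym; apply: (uniq_perm uq) => [|J]; first by rewrite map_inj_uniq.
rewrite mem_enum inE; symmetry; apply/mapP; have [sh' _ shK] := injF_bij sh_inj.
by exists (sh' J); rewrite ?mem_enum ?shK.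
Qed.

(** With this margin of two cells the block stops short of the last cell, the only place where a
    factor is replaced. *)
Lemma ub_val_early i (J : grid m) y : y + (m i).*2 <= L i ->
  ub_val i J (pos (m i) (L i) y (J i) %/ m i) =
  (y %/ m i + (J i < y %% m i)) %% ub_len U i J.
Proof.
move=> le; have le_y : y + m i <= L i by clear -le; lia.
have mi := m_gt0 i; have lt := offset_lt mi y (J i).
rewrite /ub_val; case: ifP => [/andP[/and3P[_ dv _] /eqP e]|_]; last first.
  by rewrite pos_div_small ?double_side.
suff: pos (m i) (L i) y (J i) %/ m i < L i %/ m i - 1 by rewrite e ltnn.
rewrite ltn_divLR // mulnBl divnK // mul1n /pos modn_small; last first.
  by clear -le lt; lia.
by clear -le lt; lia.
Qed.

Lemma consistent_early i c : x i + (m i).*2 <= L i ->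
  (tnth w c).2 i = (x i %/ m i + ((tnth w c).1 i < x i %% m i)) %% ub_len U i (tnth w c).1.
Proof.
move=> le; rewrite -ub_val_early //; apply: consistent_symbol (consistent_self i) _.
by rewrite /regular; apply/orP; right; clear -le; lia.
Qed.

(** The bit is moved to the other side, [ub_len - 1] acting as -1, so that the congruence is solved
    for the quotient. *)
Lemma symbol_congruence i c : x i + (m i).*2 <= L i ->
  x i %/ m i = (tnth w c).2 i + (ub_len U i (tnth w c).1 - 1) *
    ((tnth w c).1 i < x i %% m i) %[mod ub_len U i (tnth w c).1].
Proof.
move=> le; rewrite consistent_early // modnDml.
have len := len_gt0 i (tnth w c).1.
case: (_ < _); last by rewrite muln0 !addn0.
by rewrite muln1 -addnA subnKC // modnDr.
Qed.

(** Reducing the quotient modulo [M] can only lower the point, which keeps the margin before the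
    end; residues are unchanged, and so are the observed factors, whose lengths divide [M]. *)
Lemma consistent_candidate i M : x i + (m i).*2 <= L i ->
    (forall c, ub_len U i (tnth w c).1 %| M) ->
  consistent i w ((x i %/ m i) %% M * m i + x i %% m i).
Proof.
move=> le dvM; have mi := m_gt0 i; set y := _ + _.
have y_mod : y %% m i = x i %% m i by rewrite modnMDl modn_mod.
have y_div : y %/ m i = (x i %/ m i) %% M.
  by rewrite divnMDl // [_ %% m i %/ _]divn_small ?addn0 // ltn_pmod.
have le_y : y <= x i.
  by rewrite /y {3}(divn_eq (x i) (m i)) leq_add2r leq_mul2r leq_mod orbT.
have le' : y + (m i).*2 <= L i by clear -le le_y; lia.
have regular2 z : z + (m i).*2 <= L i -> regular (m i) (L i) z.
  by rewrite /regular => le_z; apply/orP; right; clear -le_z; lia.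
apply/and3P; split; first by clear -le' mi; lia.
  apply/forallP => r; rewrite count_residues; apply/eqP/eq_bigr => J _.
  rewrite !regular_mod ?regular2 ?ltn_ord ?double_side //.
  by rewrite -modnDml -y_mod modnDml.
apply/orP; right; apply/forallP => c; rewrite ub_val_early //.
rewrite consistent_early // y_mod y_div; apply/eqP.
by rewrite -modnDml -[in RHS]modnDml modn_dvdm.
Qed.

End Codeword.

End Decoding.

(** * The decoder *)

Section Decoder.

Variables (n : nat) (m : 'I_n -> nat) (m_gt0 : forall i, 0 < m i) (g : nat).
Hypotheses (n_gt0 : 0 < n) (g_ge2 : 1 < g).

Local Notation P := (\prod_(i < n) m i).

Definition instance := (ub_data m g * P.-tuple (symbol m))%type.
Definition inst_store (X : instance) : store (reg m) := input_store X.1 X.2.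

Definition is_input (r : reg m) :=
  match r with RegOut _ | RegWork _ => false | _ => true end.

Definition inputs : seq (reg m) :=
  [seq RegQ p.1 p.2 | p <- enum {: 'I_n * grid m}] ++
  [seq RegL m i | i <- enum 'I_n] ++
  [seq RegJ p.1 p.2 | p <- enum {: 'I_P * 'I_n}] ++
  [seq RegS p.1 p.2 | p <- enum {: 'I_P * 'I_n}].

Lemma mem_inputs r : (r \in inputs) = is_input r.
Proof.
apply/idP/idP.
  by rewrite !mem_cat => /or4P[] /mapP[p _ ->].
rewrite !mem_cat; case: r => //= [i J|i|c i|c i] _; apply/or4P.
- by apply/Or41/mapP; exists (i, J); rewrite ?mem_enum.
- by apply/Or42/mapP; exists i; rewrite ?mem_enum.
- by apply/Or43/mapP; exists (c, i); rewrite ?mem_enum.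
by apply/Or44/mapP; exists (c, i); rewrite ?mem_enum.
Qed.

Definition clock (X : instance) := (\sum_(r <- inputs) size (inst_store X r)).+1.

Lemma clock_gt0 X : 0 < clock X.
Proof. by []. Qed.

Lemma work_inj : injective (RegWork m).
Proof. by move=> i j []. Qed.

Lemma work_input k : ~~ is_input (RegWork m k).
Proof. by []. Qed.

Local Notation quad := (@quad_computes (reg m) (RegWork m) work_inj instance inst_store
  is_input clock clock_gt0 work_input).
Local Notation quadb p := (quad (fun X => nat_of_bool (p X))).

Lemma quad_reg r : is_input r -> quad (fun X => nat_of_bits (inst_store X r)).
Proof.
move=> in_r; apply: (quad_input work_inj clock_gt0 work_input in_r) => X.
by apply: leqW; rewrite (big_rem r) ?mem_inputs //= leq_addr.
Qed.

Lemma quad_q i J : quad (fun X => ub_q X.1 i J).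
Proof. by apply: (quad_ext _ (quad_reg (r := RegQ i J) isT)) => X; apply: bitsK. Qed.

Lemma quad_side i : quad (fun X => ub_side X.1 i).
Proof. by apply: quad_ext (quad_reg (r := RegL m i) isT) => X; apply: bitsK. Qed.

Lemma quad_index c i : quad (fun X => (tnth X.2 c).1 i).
Proof. by apply: quad_ext (quad_reg (r := RegJ c i) isT) => X; apply: bitsK. Qed.

Lemma quad_factor c i : quad (fun X => (tnth X.2 c).2 i).
Proof. by apply: quad_ext (quad_reg (r := RegS c i) isT) => X; apply: bitsK. Qed.

Lemma quad_succ f : quad f -> quad (fun X => (f X).+1).
Proof. by move=> qf; apply: quad_ext (quad_add qf (quad_const 1)) => X; rewrite addn1. Qed.

Lemma quad_dvdn f h : quad f -> quad h -> quadb (fun X => f X %| h X).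
Proof. by move=> qf qh; exact: (quad_eq (quad_mod qh qf) (quad_const 0)). Qed.

Ltac quad_tac := lazymatch goal with
  | |- quad_computes (fun X => if _ then _ else _) => apply: quad_if; quad_tac
  | |- quad_computes (fun X => nat_of_bool (@?p X && @?q X)) =>
      apply: (quad_and (p := p) (q := q)); quad_tac
  | |- quad_computes (fun X => nat_of_bool (@?p X || @?q X)) =>
      apply: (quad_or (p := p) (q := q)); quad_tac
  | |- quad_computes (fun X => nat_of_bool (~~ @?p X)) => apply: (quad_not (p := p)); quad_tac
  | |- quad_computes (fun X => nat_of_bool (@?f X <= @?h X)) =>
      apply: (quad_leq (f := f) (g := h)); quad_tac
  | |- quad_computes (fun X => nat_of_bool (@?f X %| @?h X)) =>
      apply: (quad_dvdn (f := f) (h := h)); quad_tac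
  | |- quad_computes (fun X => nat_of_bool (@eq_op _ (@?f X) (@?h X))) =>
      apply: (quad_eq (f := f) (g := h)); quad_tac
  | |- quad_computes (fun X => @?f X + @?h X) => apply: (quad_add (f := f) (g := h)); quad_tac
  | |- quad_computes (fun X => @?f X - @?h X) => apply: (quad_sub (f := f) (g := h)); quad_tac
  | |- quad_computes (fun X => @?f X * @?h X) => apply: (quad_mul (f := f) (g := h)); quad_tac
  | |- quad_computes (fun X => @?f X %/ @?h X) => apply: (quad_div (f := f) (g := h)); quad_tac
  | |- quad_computes (fun X => @?f X %% @?h X) => apply: (quad_mod (f := f) (g := h)); quad_tac
  | |- quad_computes (fun X => S (@?f X)) => apply: (quad_succ (f := f)); quad_tac
  | |- quad_computes (fun X => ub_side X.1 _) => exact: quad_side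
  | |- quad_computes (fun X => ub_q X.1 _ _) => exact: quad_q
  | |- quad_computes (fun X => nat_of_ord (_ (_ (tnth X.2 _)) _)) => exact: quad_index
  | |- quad_computes (fun _ => _) => try done; try exact: quad_const
  end.

(* A function of the index [J] of a represented color is a finite case
   distinction over [J]. *)
Lemma quad_select c (F : grid m -> instance -> nat) :
  (forall J, quad (F J)) -> quad (fun X => F (tnth X.2 c).1 X).
Proof.
move=> qF; apply: quad_ext (quad_sum (enum {: grid m}) xpredT (fun J =>
  quad_mul (quad_forall (fun k => quad_eq (quad_index c k) (quad_const (J k))))
    (qF J))) => X.
rewrite big_enum (bigD1 (tnth X.2 c).1) //= [X in _ + X]big1 => [|J ne].
  have -> : [forall k, (tnth X.2 c).1 k == (tnth X.2 c).1 k :> nat] = true.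
    exact/forallP.
  by rewrite addn0 [LHS]mul1n.
case: forallP => // eq_J; case/eqP: ne; apply/ffunP => k.
by apply/val_inj/esym/eqP/eq_J.
Qed.

Lemma quad_len i J : quad (fun X => ub_len X.1 i J).
Proof. by rewrite /ub_len; quad_tac. Qed.

Lemma quad_std_side i : quad (fun X => ub_std_side X.1 i).
Proof.
rewrite /ub_std_side /ub_Q; apply: quad_mul; first exact: quad_const.
apply: (quad_ext (f := fun X => \big[lcmn/1]_(J <- enum {: grid m}) ub_q X.1 i J)) => [X|].
  by rewrite big_enum.
elim: (enum _) => [|J s IH].
  by apply: quad_ext (quad_const 1) => X; rewrite big_nil.
by apply: quad_ext (quad_lcm (quad_q i J) IH) => X; rewrite big_cons.
Qed.

Lemma quad_val i J f : quad f -> quad (fun X => ub_val X.1 i J (f X)).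
Proof.
move=> qf; have [qlen qstd] := (quad_len i J, quad_std_side i).
by rewrite /ub_val /ub_replaced; quad_tac.
Qed.

Lemma quad_regular i f : quad f -> quadb (fun X => regular (m i) (ub_side X.1 i) (f X)).
Proof. by move=> qf; rewrite /regular; quad_tac. Qed.

Lemma quad_pos i f r : quad f -> quad (fun X => pos (m i) (ub_side X.1 i) (f X) r).
Proof. by move=> qf; rewrite /pos /offset; quad_tac. Qed.

Lemma quad_consistent i f : quad f -> quadb (fun X => consistent X.1 i X.2 (f X)).
Proof.
move=> qf; apply: quad_and; first by quad_tac.
apply: quad_and.
  apply: quad_forall => r; apply: quad_eq.
    by apply: quad_sum => c; quad_tac.
  by apply: quad_sum => J; quad_tac.
apply: quad_or; first exact: (quad_not (quad_regular _ qf)).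
apply: quad_forall => c; apply: quad_eq; first exact: quad_factor.
apply: (@quad_select c (fun J X =>
  ub_val X.1 i J (pos (m i) (ub_side X.1 i) (f X) (J i) %/ m i))) => J.
by apply: quad_val; apply: quad_div; [apply: quad_pos|apply: quad_const].
Qed.

(** The default 0 is returned only when no candidate is consistent, about which nothing is
    claimed. *)
Lemma quad_first i (s : seq (instance -> nat)) : (forall f, List.In f s -> quad f) ->
  exists d, quad d /\ forall X, (exists2 f, List.In f s & consistent X.1 i X.2 (f X)) ->
    consistent X.1 i X.2 (d X).
Proof.
elim: s => [|f s IH] qs; first by exists (fun=> 0); split=> [|X []] //; apply: quad_const.
have [h|d [qd dE]] := IH; first by move=> in_h; apply: qs; right.
have qf : quad f by apply: qs; left.
exists (fun X => if consistent X.1 i X.2 (f X) then f X else d X); split.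
  exact: (quad_if (quad_consistent i qf) qf qd).
move=> X [h in_h con]; case: ifPn => // ncon; apply: dE; exists h => //.
by case: in_h con => // <-; rewrite (negPf ncon).
Qed.

Lemma quad_decode i : exists d, quad d /\
  forall U (x : grid (ub_side U)) w, unitary_braid_code U ->
    represents_codeword m_gt0 w x -> consistent U i w (d (U, w)).
Proof.
pose len c (X : instance) := ub_len X.1 i (tnth X.2 c).1.
have q_len c : quad (len c).
  exact: (@quad_select c (fun J X => ub_len X.1 i J) (quad_len i)).
(* One Chinese remainder problem for each guess [r] of [x i %% m i]; a wrong guess yields an
   unspecified value, left to the consistency test. *)
have /fin_all_exists[z zE] (r : 'I_(m i)) : exists z, quad z /\ forall X,
    (forall c, 0 < len c X) -> forall z0,
    (forall c, z0 = (tnth X.2 c).2 i + (len c X - 1) * ((tnth X.2 c).1 i < r)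
       %[mod len c X]) ->
    z X = z0 %% \big[lcmn/1]_c len c X.
  have q_a c : quad (fun X : instance =>
      (tnth X.2 c).2 i + (len c X - 1) * ((tnth X.2 c).1 i < r)).
    apply: (quad_add (quad_factor c i)); apply: quad_mul; last by quad_tac.
    by apply: (quad_sub (q_len c)); quad_tac.
  have [z [qz zE]] := quad_crts (index_enum 'I_P) q_a q_len.
  by exists z; split.
pose late t (X : instance) := ub_side X.1 i - t.
pose early (r : 'I_(m i)) X := z r X * m i + r.
have [f|d [qd dE]] := @quad_first i
    ([seq late t | t <- iota 1 (m i).*2] ++ [seq early r | r <- enum 'I_(m i)]).
  rewrite List.in_app_iff !List.in_map_iff => -[] [t [<- _]].
    by apply: quad_sub; [apply: quad_side|apply: quad_const].
  apply: quad_add; last exact: quad_const.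
  by apply: quad_mul; [have [] := zE t|apply: quad_const].
exists d; split=> // U x w code rep; apply: (dE (U, w)).
have In_mem (T : eqType) (a : T) s : a \in s -> List.In a s.
  by elim: s => //= b s IH; rewrite inE => /orP[/eqP->|/IH]; [left|right].
have [le|lt] := leqP (x i + (m i).*2) (ub_side U i).
  have lt_r : x i %% m i < m i by apply: ltn_pmod.
  exists (early (Ordinal lt_r)).
    by apply/List.in_app_iff; right; apply: List.in_map; apply: In_mem; rewrite mem_enum.
  have [_ zr] := zE (Ordinal lt_r); rewrite /early /= (zr _ _ (x i %/ m i)) /=.
  - apply: (consistent_candidate n_gt0 g_ge2 code rep le) => c.
    exact: (biglcmn_sup c).
  - by move=> c; apply: (len_gt0 g_ge2 code).
  by move=> c; apply: (symbol_congruence n_gt0 g_ge2 code rep c le).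
exists (late (ub_side U i - x i)).
  apply/List.in_app_iff; left; apply: List.in_map; apply: In_mem.
  by rewrite mem_iota; have := ltn_ord (x i); lia.
rewrite /late /= subKn; last exact/ltnW/ltn_ord.
exact: (consistent_self n_gt0 g_ge2 code rep).
Qed.

End Decoder.

(** * Building the unary clock from the input *)

Section Counting.

Variable R : eqType.
Implicit Type st : store R.

Definition tally (a b : R) : cmd R := While a (Seq (Pop a) (Push b true)).

Lemma runs_tally a b st : a != b -> runs (tally a b) st (3 * size (st a) + 1)
  (update (update st b (nseq (size (st a)) true ++ st b)) a [::]).
Proof.
move=> ab; have ba : b != a by rewrite eq_sym.
have [p] := ubnP (size (st a)); elim: p st => // p IH st lt_p.
have [e0|/eqP ne] := eqVneq (st a) [::].
  apply: runs_eq (runs_while_stop _ e0) _ _; rewrite ?e0 //= => r.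
  by rewrite update_id ?update_id.
pose st1 := update (update st a (behead (st a))) b (true :: st b).
have body : runs (Seq (Pop a) (Push b true)) st 2 st1.
  apply: runs_eq (runs_seq (runs_pop _ _) (runs_push _ _ _)) _ _ => // r.
  by rewrite [update st _ _ b]update_neq.
have eq_a : st1 a = behead (st a) by rewrite /st1 update_neq // updateE.
have sz : size (st a) = (size (st1 a)).+1 by rewrite eq_a; case: (st a) ne.
have lt : size (st1 a) < p by rewrite -ltnS -sz.
apply: runs_eq (runs_while_step ne body (IH _ lt)) _ _; first by rewrite sz; clear; lia.
have cat_true k u : nseq k true ++ true :: u = true :: nseq k true ++ u.
  by elim: k => //= k ->.
move=> r; rewrite sz; move: (size (st1 a)) => k; rewrite /st1 /update eqxx.
by case: (r =P a) => // _; case: (r =P b) => // _; rewrite cat_true.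
Qed.

Fixpoint count_bits (a b c : R) (s : seq R) : cmd R :=
  if s is r :: s' then Seq (copy r a c) (Seq (tally a b) (count_bits a b c s')) else Skip.

Lemma runs_count_bits a b c s st : uniq [:: a; b; c] ->
    {in s, forall r, r \notin [:: a; b; c]} -> st a = [::] -> st c = [::] ->
  runs (count_bits a b c s) st (12 * \sum_(r <- s) size (st r) + 3 * size s + 1)
    (update st b (nseq (\sum_(r <- s) size (st r)) true ++ st b)).
Proof.
rewrite /= !inE !negb_or andbT => /andP[/andP[ab ac] bc] out.
elim: s st out => [|r s IH] st out ea ec.
  apply: runs_eq (runs_skip _) _ _; rewrite big_nil // => r.
  by rewrite update_id.
have := out r (mem_head _ _); rewrite !inE !negb_or => /and3P[ra rb rc].
have run1 := runs_copy ra rc ac ec ea.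
set st1 := update _ _ _ in run1.
have run2 := runs_tally st1 ab.
have b1 : st1 b = st b by rewrite /st1 update_neq // eq_sym.
have a1 : st1 a = st r by rewrite /st1 updateE.
rewrite b1 a1 in run2; set st2 := update _ _ _ in run2.
have same z : z != a -> z != b -> st2 z = st z.
  by move=> za zb; rewrite /st2 /st1 !update_neq.
have out' : {in s, forall z, z \notin [:: a; b; c]}.
  by move=> z z_in; apply: out; rewrite inE z_in orbT.
have c2 : st2 c = [::] by rewrite same // eq_sym.
have run3 := IH st2 out' (updateE _ _ _) c2.
have sum2 : \sum_(z <- s) size (st2 z) = \sum_(z <- s) size (st z).
  apply: eq_big_seq => z /out'; rewrite !inE !negb_or => /and3P[za zb _].
  by rewrite same.
rewrite sum2 in run3; apply: runs_eq (runs_seq run1 (runs_seq run2 run3)) _ _.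
  by rewrite big_cons /=; clear; lia.
move=> z; rewrite /st2 /st1 /update big_cons eqxx [b == a]eq_sym (negPf ab).
case: (z =P b) => [_|_]; first by rewrite catA -nseqD addnC.
by case: (z =P a) => // ->.
Qed.

End Counting.

(** * Writing the decoded coordinates *)

Section Emit.

Variables (n : nat) (m : 'I_n -> nat) (g : nat).

Local Notation quad := (@quad_computes (reg m) (RegWork m) (@work_inj n m) (instance m g)
  (@inst_store n m g) (@is_input n m) (@clock n m g) (@clock_gt0 n m g) (@work_input n m)).

(** Each coordinate is evaluated just above the clock and its result is moved out, so that the work
    registers are free again for the next one. *)
Lemma runs_emit (d : 'I_n -> instance m g -> nat) : (forall i, quad (d i)) ->
  forall s, uniq s -> exists c K, forall X st,
    quad_ready (RegWork m) (@inst_store n m g) (@is_input n m) (@clock n m g) X 1 st ->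
    (forall i, st (RegOut m i) = [::]) ->
  exists st', [/\ runs c st (K * clock X ^ 2) st',
    forall i, i \in s -> nat_of_bits (st' (RegOut m i)) = d i X
    & forall r, (forall i, i \in s -> r != RegOut m i) -> st' r = st r].
Proof.
move=> qd; elim=> [|i s IH] /=.
  exists Skip, 1 => X st rdy out; exists st; split=> //.
  by apply: runs_eq (runs_skip _) _ _ => //; rewrite mul1n expn_gt0.
move=> /andP[i_notin /IH[c [K H]]].
have [ci [Ki Hi]] := qd i 1.
exists (Seq c (Seq ci (move (RegWork m 1) (RegOut m i) (RegWork m 2)))).
exists (K + Ki + (8 * Ki + 2)) => X st rdy out.
have [st1 [run1 val1 out1]] := H X st rdy out.
have rdy1 : quad_ready (RegWork m) (@inst_store n m g) (@is_input n m) (@clock n m g) X 1 st1.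
  have [_ in0 clock0 free0] := rdy; split=> // [r in_r||k k_gt0].
  - by rewrite out1 ?in0 // => k _; apply: contraTneq in_r => ->.
  - by rewrite out1.
  by rewrite out1 // free0.
have [t [run2 val2 sz2]] := Hi X st1 rdy1.
have [_ _ _ free1] := rdy1.
set st2 := update _ _ t in run2.
have e2 : st2 (RegWork m 2) = [::] by rewrite /st2 update_neq ?free1.
have [d1 d2 d3] : [/\ RegWork m 1 != RegOut m i, RegWork m 1 != RegWork m 2
  & RegOut m i != RegWork m 2] by split.
have run3 := runs_move d1 d2 d3 e2.
have o2 : st2 (RegOut m i) = [::].
  rewrite /st2 update_neq // out1 ?out // => k k_in.
  by apply: contraNneq i_notin => -[->].
rewrite o2 cats0 {2 3}/st2 updateE in run3.
set st3 := update _ _ _ in run3.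
have st3E r : r != RegOut m i -> st3 r = st1 r.
  move=> ne; rewrite /st3 /st2 /update (negPf ne).
  by case: eqP => // ->; rewrite free1.
exists st3; split.
- apply: runs_eq (runs_seq run1 (runs_seq run2 run3)) _ _ => //.
  have sq : 0 < clock X ^ 2 by rewrite expn_gt0.
  have : clock X <= clock X ^ 2 by rewrite expnS expn1 leq_pmulr.
  move=> /(leq_mul (leqnn Ki)); move: sz2 sq; rewrite /= !mulnDl.
  by clear; lia.
- move=> k; rewrite inE => /predU1P[->|k_in].
    by rewrite /st3 update_neq // updateE.
  rewrite st3E ?val1 //; apply: contraNneq i_notin => -[<-] //.
move=> r r_out; rewrite st3E ?out1 // => [k k_in|]; apply: r_out.
  by rewrite inE k_in orbT.
exact: mem_head.
Qed.

End Emit.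

(** * Input lengths in terms of [ub_n0] *)

Section Sizes.

Variables (n : nat) (m : 'I_n -> nat) (m_gt0 : forall i, 0 < m i) (g : nat).
Variable U : ub_data m g.
Hypothesis code : unitary_braid_code U.

Lemma size_bits_leq k a : k < 2 ^ a -> size (bits k) <= a.
Proof. by rewrite size_bits; apply: up_log_min. Qed.

Lemma ub_q_leq i J : ub_q U i J <= 2 ^ ub_n0 U.
Proof.
apply: leq_trans (up_logP _ (isT : 1 < 2)) _; rewrite leq_exp2l //.
apply: (@leq_trans (\max_(J : grid m) up_log 2 (ub_q U i J))).
  exact: (leq_bigmax (F := fun J => up_log 2 (ub_q U i J))).
exact: (leq_bigmax (F := fun i => \max_(J : grid m) up_log 2 (ub_q U i J))).
Qed.

Lemma ub_Q_leq i : ub_Q U i <= 2 ^ (ub_n0 U * #|{: grid m}|).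
Proof.
have Q_gt0 : 0 < \prod_(J : grid m) ub_q U i J.
  by rewrite prodn_gt0 // => J; apply: ub_q_gt0.
apply: leq_trans (_ : \prod_(J : grid m) ub_q U i J <= _).
  apply: dvdn_leq => //; apply/dvdn_biglcmP => J _.
  by rewrite (bigD1 J) //= dvdn_mulr.
rewrite expnM -prod_nat_const; apply: leq_prod => J _; exact: ub_q_leq.
Qed.

Definition size_const : nat := g + \sum_i m i + #|{: grid m}| + 2.

Lemma size_input w (x : grid (ub_side U)) r : is_input r ->
  represents_codeword m_gt0 w x ->
  size (input_store U w r) <= size_const * (ub_n0 U).+1.
Proof.
move=> in_r [/allP valid _].
have le_m i : m i <= \sum_i m i by rewrite (bigD1 i) //= leq_addr.
have g_lt : g < 2 ^ g by apply: ltn_expl.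
have m_lt i : m i < 2 ^ m i by apply: ltn_expl.
set n0 := ub_n0 U; set A := size_const; have def_A : A = size_const by [].
have suff_size k a : k < 2 ^ a -> a <= A * n0.+1 -> size (bits k) <= A * n0.+1.
  by move=> /size_bits_leq; apply: leq_trans.
case: r in_r => //= [i J|i|c i|c i] _.
- apply: (suff_size _ n0.+1).
    by rewrite expnS; have := ub_q_leq i J; have := expn_gt0 2 n0; rewrite /= -/n0; clear; lia.
  by rewrite leq_pmull // def_A /size_const; clear; lia.
(* The side is at most [g * m i * ub_Q U i]; the fixed factors are bounded by [k < 2 ^ k] and the
   lcm by the product of all [ub_q U i J]. *)
- apply: (suff_size _ (g + m i + n0 * #|{: grid m}|)).
    apply: leq_ltn_trans (ub_side_le code i) _; rewrite /ub_std_side !expnD.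
    apply: leq_ltn_trans (leq_mul (leqnn _) (ub_Q_leq i)) _.
    rewrite ltn_pmul2r ?expn_gt0 //; apply: ltn_mul => //.
  rewrite mulnS; apply: leq_add; first by rewrite def_A /size_const; have := le_m i; clear; lia.
  by rewrite mulnC leq_mul2r def_A /size_const; apply/orP; right; clear; lia.
- apply: (suff_size _ (m i)); first exact: ltn_trans (ltn_ord _) (m_lt i).
  rewrite mulnS; apply: leq_trans (leq_addr _ _).
  by rewrite def_A /size_const; have := le_m i; clear; lia.
apply: (suff_size _ (g + n0)).
  have le_S : (tnth w c).2 i <= ub_len U i (tnth w c).1.
    have /forallP/(_ i) := valid _ (mem_tnth c w).
    by case/orP => [/ltnW|/andP[/eqP->]].
  apply: leq_ltn_trans le_S _; rewrite expnD /ub_len.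
  apply: leq_ltn_trans (leq_mul (leqnn _) (ub_q_leq i _)) _.
  by rewrite ltn_pmul2r ?expn_gt0.
rewrite mulnS; apply: leq_add; first by rewrite def_A /size_const; clear; lia.
by rewrite leq_pmull // def_A /size_const; clear; lia.
Qed.

Lemma clock_leq w (x : grid (ub_side U)) : represents_codeword m_gt0 w x ->
  clock (U, w) <= (size (inputs m) * size_const).+1 * (ub_n0 U).+1.
Proof.
move=> rep; rewrite /clock mulSn -mulnA addSn ltnS; apply: leq_trans (leq_addl _ _).
rewrite -sum1_size big_distrl /= big_seq [leqRHS]big_seq; apply: leq_sum => r.
by rewrite mem_inputs mul1n => in_r; apply: size_input in_r rep.
Qed.

End Sizes.

Theorem theorem7 (n : nat) (n_gt0 : 0 < n) (m : 'I_n -> nat)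
    (m_gt0 : forall i, 0 < m i) (g : nat) (g_ge2 : 2 <= g) :
  exists (P : cmd (reg m)) (K : nat),
    forall (U : ub_data m g), unitary_braid_code U ->
    forall (x : grid (ub_side U)) (w : (\prod_(i < n) m i).-tuple (symbol m)),
      represents_codeword m_gt0 w x ->
      exists (t : nat) (st : store (reg m)),
        [/\ exec P (input_store U w) t st,
            t <= K * (ub_n0 U ^ 2 + 1)
          & [\/ n = 1, (forall i, m i %| ub_side U i)
              | unambiguous m_gt0 x] ->
            forall i, output st i = x i].
Proof.
have /fin_all_exists[d dE] := quad_decode m_gt0 n_gt0 g_ge2.
have [c [K H]] := runs_emit (fun i => proj1 (dE i)) (enum_uniq 'I_n).
pose W := RegWork m; pose s := inputs m.
(* The pushed bit is the successor in [clock]; the other marks are counted from the input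
   registers. *)
exists (Seq (Push (W 0) true) (Seq (count_bits (W 1) (W 0) (W 2) s) c)).
pose A := (size s * size_const m g).+1.
(* The clock is at most [A * (ub_n0 U).+1], and the factor 2 comes from (k + 1)^2 <= 2 (k^2 + 1).
   Counting the clock accounts for [14 + 3 * size s]. *)
exists ((K + 14 + 3 * size s) * (A ^ 2 * 2)) => U code x w rep.
pose X : instance m g := (U, w); pose st0 := input_store U w.
pose st1 := update st0 (W 0) [:: true].
have run1 : runs (Push (W 0) true) st0 1 st1 by apply: runs_push.
have sum1 : \sum_(r <- s) size (st1 r) = \sum_(r <- s) size (inst_store X r).
  rewrite !big_seq; apply: eq_bigr => r; rewrite mem_inputs => in_r.
  by rewrite /st1 update_neq //; apply: contraTneq in_r => ->.
have uW : uniq [:: W 1; W 0; W 2] by [].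
have out_s : {in s, forall r, r \notin [:: W 1; W 0; W 2]}.
  by move=> r; rewrite mem_inputs; case: r.
have run2 := runs_count_bits (st := st1) uW out_s erefl erefl.
rewrite sum1 in run2; set st2 := update _ _ _ in run2.
have rdy : quad_ready W (@inst_store n m g) (@is_input n m) (@clock n m g) X 1 st2.
  split=> // [r in_r||k k_gt0].
  - rewrite /st2 /st1 !update_neq //; apply: contraTneq in_r => -> //.
  - by rewrite /st2 updateE /st1 updateE /clock -[in RHS]addn1 nseqD.
  by rewrite /st2 /st1 !update_neq //; case: k k_gt0.
have [st3 [[t run t_le] val out3]] : exists st3, [/\ runs (Seq (Push (W 0) true)
    (Seq (count_bits (W 1) (W 0) (W 2) s) c)) st0
      ((K + 14 + 3 * size s) * clock X ^ 2) st3,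
    forall i, nat_of_bits (st3 (RegOut m i)) = d i X & True].
  have [st3 [run3 val3 _]] := H X st2 rdy (fun i => erefl).
  exists st3; split=> // [|i]; last by rewrite val3 ?mem_enum.
  apply: runs_eq (runs_seq run1 (runs_seq run2 run3)) _ _ => //.
  have sq : clock X <= clock X ^ 2 by rewrite expnS expn1 leq_pmulr.
  have sq0 : 0 < clock X ^ 2 by rewrite expn_gt0.
  have def_c : clock X = (\sum_(r <- s) size (inst_store X r)).+1 by [].
  move: sq sq0 def_c; move: (clock X ^ 2) => N2; move: (clock X) => N le N2_gt0 def_N.
  have : 3 * size s <= 3 * size s * N2 by rewrite leq_pmulr.
  move: le; rewrite def_N !mulnDl; move: (\sum_(_ <- _) _) (size s) => a b.
  by clear -N2_gt0; lia.
exists t, st3; split=> //.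
  apply: leq_trans t_le _; rewrite -[leqRHS]mulnA leq_mul2l; apply/orP; right.
  have le := clock_leq code rep.
  apply: leq_trans (_ : (A * (ub_n0 U).+1) ^ 2 <= _); first by rewrite leq_exp2r.
  rewrite expnMn -mulnA leq_mul2l; apply/orP; right.
  by move: (ub_n0 U) => k; rewrite !expnS !expn0; clear; nia.
have con i : consistent U i w (d i X) by apply: (proj2 (dE i)) code rep.
move=> cond i; rewrite /output val.
have direct := consistent_inj n_gt0 g_ge2 code rep.
case: cond => [n1|dv|unamb]; [by apply: direct (con i); left|by apply: direct (con i); right|].
have lt k : d k X < ub_side U k by have /and3P[] := con k.
pose y : grid (ub_side U) := [ffun k => Ordinal (lt k)].
have yE k : y k = d k X :> nat by rewrite ffunE.
rewrite -yE; suff -> : y = x by [].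
by apply: unamb; apply: (consistent_codeword n_gt0 g_ge2 code rep) => k; rewrite yE.
Qed.
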